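(* Let $c_1,\dots,c_N$ and $L$ be positive constants. Consider the problem of choosing the distributions of the glue periods $G_1,\dots,G_N$ so as to minimize $\sum_{i=1}^N c_iU_i$ subject to $\sum_{i=1}^N\mathbb E[G_i]=L$, where $U_i$ is the approximate mean waiting time defined in the context. Under this constraint the objective function is $$\begin{aligned}\sum_{i=1}^Nc_iU_i=\;&\sum_{i=1}^N\frac{c_i(1+\rho_i)}{\rho+\sum_{j=1}^N\rho_j^2}\Bigg[\rho\Bigg(\frac{\sum_{j=1}^N\lambda_j\mathbb E[B_j^2]}{2(1-\rho)}+\frac{\mathbb E[(\sum_{j=1}^NS_j)^2]+2L\sum_{j=1}^N\mathbb E[S_j]+\mathbb E[(\sum_{j=1}^NG_j)^2]}{2\,\mathbb E[\sum_{j=1}^NS_j+L]}\Bigg)\\&+\frac{\mathbb E[\sum_{j=1}^NS_j+L]}{2(1-\rho)}\Big(\rho^2+\sum_{j=1}^N\rho_j^2\Big)\Bigg]+\sum_{i=1}^N\frac{c_i\,\mathbb E[e^{-\nu_iG_i}]}{1-\mathbb E[e^{-\nu_iG_i}]}\left(\frac{\mathbb E[\sum_{j=1}^NS_j+L]}{1-\rho}-\mathbb E[G_i]\right).\end{aligned}$$ Then: (1) If nondeterministic glue period distributions with means $g_i$ are changed to the degenerate (deterministic) ones with the same means $g_i$, $i=1,\dots,N$, then the right-hand side above becomes strictly smaller. Therefore the problem becomes: minimize $U(g_1,\dots,g_N)$ subject to $g_i>0$ ($i=1,\dots,N$) and $\sum_{i=1}^Ng_i=L$, where $$\begin{aligned}U(g_1,\dots,g_N)=\;&\sum_{i=1}^N\frac{c_i(1+\rho_i)}{\rho+\sum_{j=1}^N\rho_j^2}\Bigg[\rho\Bigg(\frac{\sum_{j=1}^N\lambda_j\mathbb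 E[B_j^2]}{2(1-\rho)}+\frac{\mathbb E[(\sum_{j=1}^NS_j)^2]+2L\sum_{j=1}^N\mathbb E[S_j]+L^2}{2\,\mathbb E[\sum_{j=1}^NS_j+L]}\Bigg)\\&+\frac{\sum_{j=1}^N\mathbb E[S_j]+L}{2(1-\rho)}\Big(\rho^2+\sum_{j=1}^N\rho_j^2\Big)\Bigg]+\sum_{i=1}^Nc_i\Big(-1+\frac{1}{1-e^{-\nu_ig_i}}\Big)\left(\frac{\sum_{j=1}^N\mathbb E[S_j]+L}{1-\rho}-g_i\right).\end{aligned}$$ (2) $U$ takes a minimum at a point of $\{(g_1,\dots,g_N):g_1>0,\dots,g_N>0,\ g_1+\dots+g_N=L\}$, and at a minimum point there exists a Lagrange multiplier $\kappa$ with $f_i(g_i)=\kappa$ for $i=1,\dots,N$, where $$f_i(g)=c_i-\frac{c_i}{1-e^{-\nu_ig}}-\frac{c_i\nu_ie^{-\nu_ig}}{(1-e^{-\nu_ig})^2}\left(\frac{\sum_{j=1}^N\mathbb E[S_j]+L}{1-\rho}-g\right).$$ (3) For each $i=1,\dots,N$, the function $f_i:(0,L)\to(-\infty,f_i(L))$ is bijective, continuous and strictly increasing; hence it has an inverse $h_i:(-\infty,f_i(L))\to(0,L)$, which is also continuous and strictly increasing. (4) The equation $\sum_{j=1}^Nh_j(\kappa)=L$, $-\infty<\kappa<\min\{f_1(L),\dots,f_N(L)\}$, has a unique solution $\kappa^*$, and the optimal solution $(g_1^*,\dots,g_N^* )$ is given by $$g_i^*=h_i(\kappa^* ),\qquad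 i=1,\dots,N.$$
   Context: The setting is a single-server cyclic polling system with multiple customer types and stations $1,\dots,N$, gated service, retrials and glue periods. Type-$i$ customers arrive at station $i$ according to a Poisson process with rate $\lambda_i$; service times at station $i$ are i.i.d. copies of $B_i$; switchover times from station $i$ to the next station are i.i.d. copies of $S_i$; interarrival, service and switchover times are mutually independent. After the server switches to station $i$ there is a glue period, followed by the visit period of station $i$; successive glue periods at station $i$ are i.i.d. copies of a random variable $G_i$. Customers arriving or retrying at station $i$ during its glue period are queued and served in the following visit period; customers arriving at other times join the orbit of station $i$, each retrying after independent exponential times with mean $1/\nu_i$. Put $\rho_i=\lambda_i\mathbb E[B_i]$ and $\rho=\sum_{i=1}^N\rho_i$, and assume $\rho<1$. The quantity $U_j$ is an approximation of the mean waiting time (until start of service) of a type-$j$ customer. With $T=\sum_{i=1}^N(S_i+G_i)$ it is $$U_j=\frac{1+\rho_j}{\rho+\sum_{i=1}^N\rho_i^2}\left\{\rho\left(\frac{\sum_{i=1}^N\lambda_i\mathbb E[B_i^2]}{2(1-\rho)}+\frac{\mathbb E[T^2]}{2\mathbb E[T]}+\rho\frac{\mathbb E[T]}{2(1-\rho)}\right)+\sum_{i=1}^N\rho_i^2\,\frac{\mathbb E[T]}{2(1-\rho)}\right\}+\frac{\mathbb E[e^{-\nu_jG_j}]}{1-\mathbb E[e^{-\nu_jG_j}]}\left(\frac{\mathbb E[T]}{1-\rho}-\mathbb E[G_j]\right).$$ *)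

(* Defs.v *)
From HB Require Import structures.
From mathcomp Require Export all_boot all_order all_algebra.
From mathcomp Require Export all_classical all_reals all_analysis.
Export Order.TTheory GRing.Theory Num.Theory.
Export numFieldNormedType.Exports.

Set Implicit Arguments.
Unset Strict Implicit.
Unset Printing Implicit Defensive.

Local Open Scope classical_set_scope.
Local Open Scope ring_scope.

Section RandomVariables.
Context {R : realType} {d : measure_display} {Omega : measurableType d}.
Variable P : probability Omega R.

(* Real-valued expectation; used only where the expectation is finite. *)
Definition mean (X : Omega -> R) : R := fine 'E_P[X].

Definition second_moment (X : Omega -> R) : \bar R := 'E_P[fun w => X w ^+ 2].

Definition lst (s : R) (X : Omega -> R) : R :=
  mean (fun w => expR (- (s * X w))).

Definition degenerate_at (X : Omega -> R) (a : R) : Prop :=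
  P (X @^-1` [set a]) = 1%E.

Definition deterministic (X : Omega -> R) : Prop := exists a, degenerate_at X a.

Definition mutually_independent (I : finType) (X : I -> {RV P >-> R}) : Prop :=
  forall (J : {set I}) (A : I -> set R), (forall i, measurable (A i)) ->
    P (\bigcap_(i in [set` J]) (X i @^-1` A i)) =
    (\prod_(i in J) P (X i @^-1` A i))%E.

Definition joint (I J : finType) (X : I -> {RV P >-> R})
    (Y : J -> {RV P >-> R}) (k : I + J) : {RV P >-> R} :=
  match k with inl i => X i | inr j => Y j end.

Definition deterministic_glue (N : nat) (g : 'I_N -> R) (i : 'I_N) :
  {RV P >-> R} := cst (g i).

End RandomVariables.

Section Polling.
Context {R : realType} {N : nat}.
Context {d : measure_display} {Omega : measurableType d}.
Context {P : probability Omega R}.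
Implicit Types (lam nu c g : 'I_N -> R) (L : R) (B S G : 'I_N -> {RV P >-> R}).

Definition load lam B (i : 'I_N) : R := lam i * mean P (B i).

Definition total_load lam B : R := \sum_i load lam B i.

Definition sq_load lam B : R := \sum_i load lam B i ^+ 2.

Definition service_term lam B : R :=
  (\sum_i lam i * fine (second_moment P (B i))) / (2 * (1 - total_load lam B)).

Definition total (X : 'I_N -> {RV P >-> R}) (w : Omega) : R := \sum_i X i w.

Definition switch_glue S G (w : Omega) : R := \sum_i (S i w + G i w).

(* The approximate mean waiting time U_j. It is +oo when the glue periods have
   an infinite second moment. *)
Definition waiting_time lam nu B S G (j : 'I_N) : \bar R :=
  let rho := total_load lam B in
  let ET := mean P (switch_glue S G) in
  let phi := lst P (nu j) (G j) in
  (((1 + load lam B j) / (rho + sq_load lam B))%:E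
     * (rho%:E * ((service_term lam B)%:E
                  + second_moment P (switch_glue S G) / (2 * ET)%:E
                  + (rho * (ET / (2 * (1 - rho))))%:E)
        + (sq_load lam B * (ET / (2 * (1 - rho))))%:E)
   + (phi / (1 - phi) * (ET / (1 - rho) - mean P (G j)))%:E)%E.

Definition objective lam nu c B S G : \bar R :=
  (\sum_i (c i)%:E * waiting_time lam nu B S G i)%E.

Definition constrained_objective lam nu c L B S G : \bar R :=
  let rho := total_load lam B in
  let ESL := mean P (fun w => total S w + L) in
  (\sum_i
     (c i * (1 + load lam B i) / (rho + sq_load lam B))%:E
       * (rho%:E * ((service_term lam B)%:E
                    + (second_moment P (total S)
                       + (2 * L * \sum_j mean P (S j))%:E
                       + second_moment P (total G)) / (2 * ESL)%:E)
          + (ESL / (2 * (1 - rho)) * (rho ^+ 2 + sq_load lam B))%:E)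
   + \sum_i
       (c i * lst P (nu i) (G i) / (1 - lst P (nu i) (G i))
          * (ESL / (1 - rho) - mean P (G i)))%:E)%E.

Definition reduced_objective lam nu c L B S g : R :=
  let rho := total_load lam B in
  let ESL := mean P (fun w => total S w + L) in
  let K := \sum_j mean P (S j) + L in
  \sum_i
     c i * (1 + load lam B i) / (rho + sq_load lam B)
       * (rho * (service_term lam B
                 + (fine (second_moment P (total S))
                    + 2 * L * \sum_j mean P (S j)
                    + L ^+ 2) / (2 * ESL))
          + K / (2 * (1 - rho)) * (rho ^+ 2 + sq_load lam B))
  + \sum_i c i * (- 1 + 1 / (1 - expR (- (nu i * g i)))) * (K / (1 - rho) - g i).

Definition multiplier_fun lam nu c L B S (i : 'I_N) (x : R) : R :=
  let e := expR (- (nu i * x)) in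
  c i - c i / (1 - e)
  - c i * nu i * e / (1 - e) ^+ 2
    * ((\sum_j mean P (S j) + L) / (1 - total_load lam B) - x).

Definition feasible L g : Prop := (forall i, 0 < g i) /\ \sum_i g i = L.

Definition is_minimum_point lam nu c L B S g : Prop :=
  feasible L g /\
  forall g', feasible L g' ->
    reduced_objective lam nu c L B S g <= reduced_objective lam nu c L B S g'.

End Polling.

Definition same_distribution (R : realType)
    (d : measure_display) (Omega : measurableType d) (P : probability Omega R)
    (d' : measure_display) (Omega' : measurableType d')
    (P' : probability Omega' R)
    (X : {RV P >-> R}) (X' : {RV P' >-> R}) : Prop :=
  (* The values of a measure on non-measurable sets are unconstrained. *)
  forall A : set R, measurable A -> distribution P X A = distribution P' X' A.

(* The decision variables of the original problem are the distributions of the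
   glue periods, so a choice of these is presented by random variables G' on
   any probability space that also carries copies B', S' of the service and
   switchover times of the system. The condition 0 < E[G'_i] excludes glue
   periods that vanish almost surely, for which U_i is undefined. *)
Definition glue_design (R : realType) (N : nat)
    (d : measure_display) (Omega : measurableType d) (P : probability Omega R)
    (B S : 'I_N -> {RV P >-> R}) (L : R)
    (d' : measure_display) (Omega' : measurableType d')
    (P' : probability Omega' R) (B' S' G' : 'I_N -> {RV P' >-> R}) : Prop :=
  [/\ forall i, same_distribution (B i) (B' i),
      forall i, same_distribution (S i) (S' i),
      mutually_independent (joint (joint B' S') G'),
      forall i, {ae P', forall w, 0 <= G' i w} &
      (forall i, 0 < 'E_P'[G' i])%E /\ (\sum_i 'E_P'[G' i] = L%:E)%E].

Definition optimal_glue_design (R : realType) (N : nat) (lam nu c : 'I_N -> R)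
    (d : measure_display) (Omega : measurableType d) (P : probability Omega R)
    (B S : 'I_N -> {RV P >-> R}) (L : R)
    (d' : measure_display) (Omega' : measurableType d')
    (P' : probability Omega' R) (B' S' G' : 'I_N -> {RV P' >-> R}) : Prop :=
  glue_design B S L B' S' G' /\
  forall (d1 : measure_display) (Omega1 : measurableType d1)
    (P1 : probability Omega1 R) (B1 S1 G1 : 'I_N -> {RV P1 >-> R}),
    glue_design B S L B1 S1 G1 ->
    (objective lam nu c B' S' G' <= objective lam nu c B1 S1 G1)%E.

(* Main.v *)
Require Import Defs.
From HB Require Import structures.
From mathcomp Require Import measurable_realfun.
From mathcomp Require Import ring lra.

Set Implicit Arguments.
Unset Strict Implicit.
Unset Printing Implicit Defensive.

Local Open Scope classical_set_scope.
Local Open Scope ring_scope.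

(** Write [K = sum_j E S_j + L] for the mean of the sum of all switchover and
    glue periods and [A = K / (1 - rho)] for the mean cycle time.

    Reduction to constants. Under the constraint the glue periods enter the
    objective only through [v = E (sum_j G_j)^2], the transforms
    [psi_i = E exp (- nu_i G_i)] and the means [g_i], the switchover times being
    independent of the glue periods ([objective_fin], [objective_pinfty]). The
    resulting expression [objective_value] is nondecreasing in [v] and strictly
    increasing in each [psi_i < 1], because [g_i <= L < A]
    ([objective_value_lt]). By Jensen's inequality [v >= L^2]
    ([second_moment_ge]) and [psi_i >= exp (- nu_i g_i)] ([lst_ge]), the latter
    strictly unless [G_i] is constant ([lst_gt]). Hence replacing the glue
    periods by their means never increases the objective and strictly
    decreases it unless they were all constant already ([design_ge],
    [design_gt]). Since every feasible vector of constants is realized on the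
    original probability space, the optimal designs are exactly the constant
    ones at minimum points of the reduced objective ([optimal_designP]); this
    comparison across probability spaces uses that independence and the
    marginals determine the second moment of the total switchover time
    ([same_second_moment_total]).

    The reduced problem. Up to a constant, the reduced objective is the sum of
    the functions
    [c_i (- 1 + 1 / (1 - exp (- nu_i x))) (A - x)], whose derivative [f_i] is a
    sum of negatives of products of nonnegative decreasing functions, hence
    strictly increasing on [(0, A]] ([retrial_slope_lt]), and it tends to
    [-oo] at [0] ([retrial_slope_unbounded]). So [f_i] has a continuous
    increasing inverse [h_i] ([slope_inverse]), and the tangent inequality is
    strict ([retrial_cost_above_tangent]). Summing tangent inequalities, a
    feasible point at which all [f_i] take the same value is the unique minimum
    point ([equal_slopes_optimal]). For [N > 1] such a point is [h_i kappa],
    where [kappa] solves [sum_i h_i kappa = L]: this sum is continuous and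
    strictly increasing, and it takes values on both sides of [L]
    ([multiplier_exists]). For [N = 1] the only feasible point is [L]. *)

(** * The retrial cost of one station *)

Section RetrialCost.
Context {R : realType}.
Variables (c nu A : R).
Hypotheses (c_gt0 : 0 < c) (nu_gt0 : 0 < nu).

Let q (x : R) := expR (- (nu * x)).

Definition retrial_cost (x : R) : R :=
  c * (- 1 + 1 / (1 - expR (- (nu * x)))) * (A - x).

Definition retrial_slope (x : R) : R :=
  let e := expR (- (nu * x)) in
  c - c / (1 - e) - c * nu * e / (1 - e) ^+ 2 * (A - x).

Lemma expR_neg_lt1 (x : R) : 0 < x -> expR (- (nu * x)) < 1.
Proof. by move=> x0; rewrite -expR0 ltr_expR oppr_lt0 mulr_gt0. Qed.

Lemma retrial_cost_is_derive (x : R) : 0 < x ->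
  is_derive x 1 retrial_cost (retrial_slope x).
Proof.
move=> x0; have q1 := expR_neg_lt1 x0.
have q1' : 1 - expR (- (nu * x)) != 0 by rewrite gt_eqF ?subr_gt0.
have dq : is_derive x 1 q (- (nu * q x)).
  have -> : q = expR \o (fun x => - (nu * x)) by [].
  apply: is_derive_eq.
  rewrite /= /GRing.scale /= /q; ring.
have -> : retrial_cost = (fun y => c * (- 1 + (1 - q y)^-1) * (A - y)).
  by apply/funext => y; rewrite /retrial_cost div1r.
have d1q : is_derive x 1 (fun y => 1 - q y) (nu * q x).
  by apply: is_derive_eq; rewrite /=; ring.
have dV : is_derive x 1 (fun y => (1 - q y)^-1) (- (1 - q x) ^- 2 *: (nu * q x)).
  exact: is_deriveV.
apply: is_derive_eq.
rewrite /retrial_slope /= -/(q x) /GRing.scale /=.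
by field.
Qed.

Lemma retrial_cost_continuous (x : R) : 0 < x -> {for x, continuous retrial_cost}.
Proof.
move=> x0; apply/differentiable_continuous/derivable1_diffP.
by have [] := retrial_cost_is_derive x0.
Qed.

Lemma retrial_slope_continuous (x : R) : 0 < x -> {for x, continuous retrial_slope}.
Proof.
move=> x0; have q1 := expR_neg_lt1 x0.
have q1' : 1 - expR (- (nu * x)) != 0 by rewrite gt_eqF ?subr_gt0.
have cq : {for x, continuous q}.
  apply: continuous_comp; last exact: continuous_expR.
  by apply: continuousN; apply: continuousM; [exact: cst_continuous|exact: cvg_id].
have c1q : {for x, continuous (fun y => 1 - q y)}.
  by apply: continuousB => //; exact: cst_continuous.
apply: continuousB.
  apply: continuousB; first exact: cst_continuous.
  by apply: continuousM; [exact: cst_continuous|exact: continuousV].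
apply: continuousM.
  apply: continuousM.
    by apply: continuousM => //; exact: cst_continuous.
  apply: (@continuousV _ _ (fun y => (1 - q y) ^+ 2)).
    by rewrite expf_neq0.
  apply: (@continuous_comp _ _ _ (fun y => 1 - q y) (fun z : R => z ^+ 2)) => //.
  exact: exprn_continuous.
by apply: continuousB; [exact: cst_continuous|exact: cvg_id].
Qed.

(** With [e = exp (- nu x)], the negated slope is the sum of [c e / (1 - e)]
    and [c nu e / (1 - e)^2 (A - x)], both products of nonnegative decreasing
    factors. *)
Lemma retrial_slope_lt (x y : R) : 0 < x -> x < y -> y <= A ->
  retrial_slope x < retrial_slope y.
Proof.
move=> x0 xy yA; have y0 := lt_trans x0 xy.
rewrite /retrial_slope.
have := expR_neg_lt1 x0; have := expR_neg_lt1 y0.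
have : expR (- (nu * y)) < expR (- (nu * x)).
  by rewrite ltr_expR ltrN2 ltr_pM2l.
have := expR_gt0 (- (nu * y)).
move: (expR (- (nu * y))) (expR (- (nu * x))) => u v u0 uv u1 v1.
have a0 : 0 < 1 - v by rewrite subr_gt0.
have inv : (1 - u)^-1 < (1 - v)^-1 by rewrite ltf_pV2 ?posrE; lra.
have i0 : 0 < (1 - u)^-1 by rewrite invr_gt0; lra.
have h1 : c / (1 - u) < c / (1 - v) by rewrite ltr_pM2l.
have h2 : u / (1 - u) ^+ 2 * (A - y) <= v / (1 - v) ^+ 2 * (A - x).
  apply: ler_pM; [|lra| |lra].
    by rewrite divr_ge0 ?exprn_ge0; lra.
  rewrite -!exprVn; apply: ler_pM; [lra| |lra|].
    by rewrite exprn_ge0 ?ltW.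
  by rewrite lerXn2r ?nnegrE ?ltW // (lt_trans i0).
have h3 : c * nu * u / (1 - u) ^+ 2 * (A - y) <=
    c * nu * v / (1 - v) ^+ 2 * (A - x).
  rewrite -!(mulrA (c * nu)) ler_pM2l ?mulr_gt0 //.
lra.
Qed.

(** From [1 - exp (- nu x) <= nu x], the slope is at most [c - c / (nu x)]. *)
Lemma retrial_slope_unbounded (L k : R) : 0 < L -> L <= A ->
  exists2 x, 0 < x < L & retrial_slope x <= k.
Proof.
move=> L0 LA.
have ck : 0 < c + `|k| by rewrite ltr_wpDr.
(* The second bound makes [c / (nu x)] at least [c + `|k|]. *)
pose x := Num.min (L / 2) (c / (nu * (c + `|k|))).
have xL : x <= L / 2 by rewrite ge_min lexx.
have x0 : 0 < x by rewrite lt_min !divr_gt0 ?mulr_gt0.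
have xc : x <= c / (nu * (c + `|k|)) by rewrite ge_min lexx orbT.
exists x; first by apply/andP; split => //; lra.
have q1 := expR_neg_lt1 x0.
have q0 := expR_gt0 (- (nu * x)).
have nux0 : 0 < nu * x by rewrite mulr_gt0.
have qx : 1 - expR (- (nu * x)) <= nu * x.
  by have := expR_ge1Dx (- (nu * x)); lra.
rewrite /retrial_slope.
set e := expR _ in q1 q0 qx *.
have h1 : 0 <= c * nu * e / (1 - e) ^+ 2 * (A - x).
  apply: mulr_ge0; last lra.
  by rewrite divr_ge0 ?exprn_ge0 ?mulr_ge0 ?ltW// ; lra.
have h2 : c + `|k| <= c / (1 - e).
  rewrite ler_pdivlMr; last by lra.
  apply: (@le_trans _ _ ((c + `|k|) * (nu * x))); first by rewrite ler_pM2l.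
  move: xc; rewrite ler_pdivlMr ?mulr_gt0 // => xc; apply: le_trans xc.
  by rewrite mulrC -mulrA mulrCA mulrA mulrC.
have := ler_norm (- k); rewrite normrN; lra.
Qed.

(** Strict convexity of the cost on [(0, A]]: by the mean value theorem the
    increment is [y - x] times the slope at a point strictly between [x] and
    [y], and the slope is strictly increasing. *)
Lemma retrial_cost_above_tangent (x y : R) : 0 < x -> 0 < y -> x <= A -> y <= A ->
  x != y ->
  retrial_slope x * (y - x) < retrial_cost y - retrial_cost x.
Proof.
move=> x0 y0 xA yA.
have mvt a b : 0 < a -> a < b -> exists2 z, a < z < b &
    retrial_cost b - retrial_cost a = retrial_slope z * (b - a).
  move=> a0 ab; have [||z zab ->] := @MVT R retrial_cost retrial_slope a b ab.
  - move=> z; rewrite in_itv /= => /andP[az _].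
    by apply: retrial_cost_is_derive; exact: lt_trans az.
  - apply: continuous_in_subspaceT => z; rewrite inE /= in_itv /= => /andP[az _].
    by apply: retrial_cost_continuous; exact: lt_le_trans az.
  by exists z => //; move: zab; rewrite in_itv.
rewrite neq_lt => /orP[xy|yx].
  have [z /andP[xz zy] ->] := mvt _ _ x0 xy.
  by rewrite ltr_pM2r ?subr_gt0// retrial_slope_lt// (le_trans (ltW zy)).
have [z /andP[yz zx] e] := mvt _ _ y0 yx.
rewrite -(opprB x y) -(opprB (retrial_cost x)) e mulrN ltrN2.
by rewrite ltr_pM2r ?subr_gt0// retrial_slope_lt// (lt_trans y0).
Qed.

End RetrialCost.

(** * Inverses of increasing slopes *)

Section InverseOnInterval.
Context {R : realType}.
Variables (f : R -> R) (L : R).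
Hypothesis f_lt : forall x y : R, 0 < x -> x < y -> y <= L -> f x < f y.
Hypothesis f_continuous : forall x : R, 0 < x -> {for x, continuous f}.
Hypothesis f_unbounded : forall k : R, exists2 x, 0 < x < L & f x <= k.

Lemma slope_attained k : k < f L -> exists2 x, 0 < x < L & f x = k.
Proof.
move=> kL; have [a /andP[a0 aL] fa] := f_unbounded k.
have [||x] := @IVT R f a L k (ltW aL).
- apply: continuous_in_subspaceT => x; rewrite inE /= in_itv /= => /andP[ax _].
  by apply: f_continuous; exact: lt_le_trans ax.
- by rewrite ge_min fa /= le_max (ltW kL) orbT.
rewrite in_itv /= => /andP[ax xL] fx; exists x => //.
rewrite (lt_le_trans a0 ax) lt_neqAle xL andbT.
by apply: contraTneq kL => xe; rewrite -fx xe ltxx.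
Qed.

Lemma slope_set_bij : set_bij `]0, L[ `]-oo, f L[ f.
Proof.
split.
- move=> x /=; rewrite !in_itv /= => /andP[x0 xL]; exact: f_lt.
- move=> x y; rewrite !inE /= !in_itv /= => /andP[x0 xL] /andP[y0 yL] fxy.
  by have [xy|yx|//] := ltgtP x y; [have := f_lt x0 xy (ltW yL)|
    have := f_lt y0 yx (ltW xL)]; rewrite fxy ltxx.
- move=> k /=; rewrite in_itv /= => kL; have [x xL fx] := slope_attained kL.
  by exists x => //=; rewrite in_itv.
Qed.

(** Continuity of the inverse is local: near a point of the open interval, [f]
    is continuous and injective. *)
Lemma slope_inverse : exists h : R -> R,
  [/\ set_fun `]-oo, f L[ `]0, L[ h,
      {in `]0, L[, cancel f h},
      {in `]-oo, f L[, cancel h f},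
      {in `]-oo, f L[, continuous h} &
      {in `]-oo, f L[ &, {homo h : x y / x < y}}].
Proof.
have [h hP] : {h : R -> R & forall k, k < f L -> 0 < h k < L /\ f (h k) = k}.
  apply: (@choice _ _ (fun k x => k < f L -> 0 < x < L /\ f x = k)) => k.
  have [kL|kL] := pselect (k < f L); last by exists 0 => /kL.
  by have [x xL fx] := slope_attained kL; exists x.
have inj x y : 0 < x < L -> 0 < y < L -> f x = f y -> x = y.
  move=> xL yL; have [_ + _] := slope_set_bij; apply; rewrite inE /= in_itv //.
have fh : {in `]0, L[, cancel f h}.
  move=> x; rewrite in_itv /= => xL.
  have xfL : f x < f L by case/andP: xL => x0 xL; exact: f_lt.
  by have [hfx fhfx] := hP _ xfL; exact: inj.
exists h; split => //.
- by move=> k /=; rewrite !in_itv /= => kL; have [] := hP _ kL.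
- by move=> k /=; rewrite !in_itv /= => kL; have [] := hP _ kL.
- move=> k; rewrite in_itv /= => kL.
  have [hkL fhk] := hP _ kL.
  have hkI : h k \in `]0, L[ by rewrite in_itv.
  have near_hk := near_in_itv hkI.
  suff /nbhs_singleton : {near f (h k), continuous h} by rewrite fhk.
  apply: near_can_continuous.
    by near=> x; apply: fh; near: x; exact: near_hk.
  near=> x; apply: f_continuous.
  have : x \in `]0, L[ by near: x; exact: near_hk.
  by rewrite in_itv /= => /andP[].
- move=> k l; rewrite !in_itv /= => kL lL kl.
  have [/andP[hk0 _] fhk] := hP _ kL; have [/andP[_ hlL] fhl] := hP _ lL.
  rewrite ltNge; apply/negP; rewrite le_eqVlt => /orP[/eqP e|hlk].
    by move: kl; rewrite -fhk -fhl e ltxx.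
  have [/andP[hl0 _] _] := hP _ lL; have [/andP[_ hkL] _] := hP _ kL.
  by have := f_lt hl0 hlk (ltW hkL); rewrite fhk fhl ltNge (ltW kl).
Unshelve. all: by end_near. Qed.

End InverseOnInterval.

(** * The multiplier equation *)

Section MultiplierEquation.
Context {R : realType} {N : nat}.
Variables (f h : 'I_N -> R -> R) (L : R).
Hypothesis N_gt1 : (1 < N)%N.
Hypothesis L_gt0 : 0 < L.
Hypothesis f_lt : forall i (x y : R), 0 < x -> x < y -> y <= L -> f i x < f i y.
Hypothesis h_fun : forall i, set_fun `]-oo, f i L[ `]0, L[ (h i).
Hypothesis fK : forall i, {in `]0, L[, cancel (f i) (h i)}.
Hypothesis h_continuous : forall i, {in `]-oo, f i L[, continuous (h i)}.
Hypothesis h_lt : forall i, {in `]-oo, f i L[ &, {homo h i : x y / x < y}}.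

Let h_le i (x y : R) : x <= y -> y < f i L -> h i x <= h i y.
Proof.
rewrite le_eqVlt => /orP[/eqP -> //|xy] yL.
by rewrite ltW// h_lt// in_itv //=; exact: lt_trans yL.
Qed.

Lemma multiplier_unique (k l : R) :
  (forall i, k < f i L) -> (forall i, l < f i L) ->
  \sum_i h i k = \sum_i h i l -> k = l.
Proof.
have i0 : 'I_N by exact: (Ordinal (ltnW N_gt1)).
have lt_sum (a b : R) : (forall i, b < f i L) -> a < b ->
    \sum_i h i a < \sum_i h i b.
  move=> bL ab; apply: ltr_sum => [|i _].
    by apply/hasP; exists i0; rewrite ?mem_index_enum.
  by rewrite h_lt// in_itv //=; exact: lt_trans (bL i).
move=> kL lL e; have [kl|lk|//] := ltgtP k l.
  by have := lt_sum _ _ lL kl; rewrite e ltxx.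
by have := lt_sum _ _ kL lk; rewrite e ltxx.
Qed.

(** The intermediate value theorem applies to [sum_i h_i] between [a], where
    every [h_i] is at most [L / N], and [b], where two of the [h_i] already
    add up to at least [L]. *)
Lemma multiplier_exists :
  exists k, (forall i, k < f i L) /\ \sum_i h i k = L.
Proof.
have N_gt0 : (0 < N)%N by exact: ltnW.
pose i0 : 'I_N := Ordinal N_gt0.
have h_itv i x : x < f i L -> 0 < h i x < L.
  by move=> xL; have := @h_fun i x; rewrite /= !in_itv /=; apply.
have LN0 : 0 < L / N%:R by rewrite divr_gt0 ?ltr0n.
have LNL : L / N%:R < L.
  by rewrite ltr_pdivrMr ?ltr0n// ltr_pMr// ltr1n.
pose j0 := [arg min_(i < i0) f i L]%O.
have j0_min i : f j0 L <= f i L.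
  by rewrite /j0; case: arg_minP => // j _; apply.
pose m0 := [arg min_(i < i0) f i (L / N%:R)]%O.
have m0_min i : f m0 (L / N%:R) <= f i (L / N%:R).
  by rewrite /m0; case: arg_minP => // j _; apply.
pose a := f m0 (L / N%:R).
have aL i : a < f i L by apply: le_lt_trans (m0_min i) _; exact: f_lt.
have sum_a : \sum_i h i a <= L.
  have -> : L = \sum_(i < N) L / N%:R.
    by rewrite sumr_const card_ord -[RHS]mulr_natr divfK// pnatr_eq0 -lt0n.
  apply: ler_sum => i _; rewrite -(@fK i (L / N%:R)); last by rewrite in_itv /= LN0.
  by apply: h_le; [exact: m0_min|exact: f_lt].
(* For [j0] with the smallest [f j0 L] and another index [k0], put
   [eps = h k0 a]; at a level [b >= a] at which [h j0] is at least [L - eps], the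
   two terms add up to at least [L]. *)
have [k0 k0j0] : exists k0 : 'I_N, k0 != j0.
  have [e|ne] := eqVneq i0 j0; last by exists i0.
  by exists (Ordinal N_gt1); rewrite -e.
have /andP[eps0 epsL] := h_itv _ _ (aL k0).
set eps := h k0 a in eps0 epsL.
have Leps : L - eps \in `]0, L[ by rewrite in_itv /=; apply/andP; split; lra.
have fLeps : f j0 (L - eps) < f j0 L by apply: f_lt; lra.
pose b := Num.max a (f j0 (L - eps)).
have bL i : b < f i L.
  by rewrite gt_max aL /= (lt_le_trans fLeps).
have ab : a <= b by rewrite le_max lexx.
have sum_b : L <= \sum_i h i b.
  rewrite (bigD1 j0) //= (bigD1 k0) //= addrA ler_wpDr //.
    by apply: sumr_ge0 => i _; have /andP[/ltW] := h_itv _ _ (bL i).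
  have h1 : L - eps <= h j0 b.
    by rewrite -(fK j0 Leps) h_le// le_max lexx orbT.
  have h2 : eps <= h k0 b by exact: h_le.
  lra.
have [||x] := @IVT R (fun k => \sum_i h i k) a b L ab.
- apply: continuous_in_subspaceT => x; rewrite inE /= in_itv /= => /andP[_ xb].
  apply: cvg_big => [|i _]; [exact: add_continuous|apply: h_continuous].
  by rewrite in_itv /=; exact: le_lt_trans (bL i).
- by rewrite ge_min sum_a /= le_max sum_b orbT.
rewrite in_itv /= => /andP[_ xb] sx; exists x; split => // i.
exact: le_lt_trans (bL i).
Qed.

End MultiplierEquation.

(** * Optimality of points with equal slopes *)

Lemma feasible_le (R : realType) (N : nat) (L : R) (g : 'I_N -> R) i :
  (forall k, 0 <= g k) -> \sum_k g k = L -> g i <= L.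
Proof. by move=> g0 <-; rewrite (bigD1 i) //= lerDl sumr_ge0. Qed.

Section Allocation.
Context {R : realType} {N : nat} (c nu : 'I_N -> R) (A L : R).
Hypothesis c_gt0 : forall i, 0 < c i.
Hypothesis nu_gt0 : forall i, 0 < nu i.
Hypothesis L_le : L <= A.

Let cost i := retrial_cost (c i) (nu i) A.
Let slope i := retrial_slope (c i) (nu i) A.

(** Summed over [i], the strict tangent inequalities at a feasible point with
    equal slopes [kappa] have total linear term [kappa (L - L) = 0]. *)
Lemma equal_slopes_optimal (g g' : 'I_N -> R) (kappa : R) :
  feasible L g -> feasible L g' -> (forall i, slope i (g i) = kappa) ->
  (exists i, g i != g' i) ->
  \sum_i cost i (g i) < \sum_i cost i (g' i).
Proof.
move=> gf gf' eq_slope [i gi].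
have le_A h k : feasible L h -> h k <= A.
  move=> [h0 hL]; apply: le_trans L_le; apply: feasible_le => // j.
  exact: ltW.
have tangent k : g k != g' k ->
    kappa * (g' k - g k) < cost k (g' k) - cost k (g k).
  rewrite -(eq_slope k); apply: retrial_cost_above_tangent => //;
    by [case: gf|case: gf'|exact: le_A].
have tangent_le k : kappa * (g' k - g k) <= cost k (g' k) - cost k (g k).
  by have [->|/tangent/ltW//] := eqVneq (g k) (g' k); rewrite !subrr mulr0.
rewrite -subr_gt0 -sumrB.
have lin0 : \sum_k kappa * (g' k - g k) = 0.
  rewrite -mulr_sumr sumrB; case: gf => _ ->; case: gf' => _ ->.
  by rewrite subrr mulr0.
rewrite -[ltLHS]lin0 (bigD1 i) //= [ltRHS](bigD1 i) //=.
apply: ltr_leD; first exact: tangent.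
by apply: ler_sum => k _; exact: tangent_le.
Qed.

End Allocation.

(** * Second moments of sums *)

Section Moments.
Context {R : realType} {d : measure_display} {Omega : measurableType d}.
Variable P : probability Omega R.
Implicit Types X Y : {RV P >-> R}.

Lemma ae_integral_eq (f g : Omega -> R) :
  measurable_fun setT f -> measurable_fun setT g ->
  {ae P, forall w, f w = g w} ->
  (\int[P]_w (f w)%:E = \int[P]_w (g w)%:E)%E.
Proof.
move=> mf mg fg; apply: ae_eq_integral => //.
- exact/measurable_EFinP.
- exact/measurable_EFinP.
- by move: fg; apply: filterS => w /= ->.
Qed.

(** For almost surely nonnegative variables this is the mean of the product.
    The absolute values make the integrand nonnegative everywhere, so that
    cross moments add up without integrability conditions. *)
Definition cross_moment (X Y : Omega -> R) : \bar R :=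
  (\int[P]_w (`|X w| * `|Y w|)%:E)%E.

Lemma cross_momentC (X Y : Omega -> R) : cross_moment X Y = cross_moment Y X.
Proof. by apply: eq_integral => w _; rewrite mulrC. Qed.

Lemma cross_moment_diag X : cross_moment X X = second_moment P X.
Proof.
rewrite /second_moment unlock; apply: eq_integral => w _.
by rewrite -expr2 real_normK// num_real.
Qed.

Lemma measurable_abs X : measurable_fun setT (fun w => `|X w|).
Proof. by apply: measurableT_comp => //; exact: measurable_funPT. Qed.

Lemma measurable_cross X Y : measurable_fun setT (fun w => `|X w| * `|Y w|).
Proof. by apply: measurable_funM; exact: measurable_abs. Qed.

(** The square of the sum is expanded inside the integral; both sides may be
    infinite. *)
Lemma second_moment_sum (I : finType) (X : I -> {RV P >-> R}) :
  (forall i, {ae P, forall w, 0 <= X i w}) ->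
  second_moment P (fun w => \sum_i X i w) =
  (\sum_i \sum_j cross_moment (X i) (X j))%E.
Proof.
move=> X0; rewrite /second_moment unlock.
rewrite (@ae_integral_eq _ (fun w => \sum_i \sum_j (`|X i w| * `|X j w|))).
- under eq_integral do rewrite -sumEFin.
  rewrite ge0_integral_sum //=.
  + apply: eq_bigr => i _.
    under eq_integral do rewrite -sumEFin.
    rewrite ge0_integral_sum //= => j.
    by apply/measurable_EFinP; exact: measurable_cross.
  + move=> i; apply/measurable_EFinP; apply: measurable_sum => j.
    exact: measurable_cross.
  + by move=> i w _; rewrite lee_fin sumr_ge0// => j _; rewrite mulr_ge0.
- apply: measurable_funX; apply: measurable_sum => i.
  exact: measurable_funPT.
- by do 2! apply: measurable_sum => ?; exact: measurable_cross.
- have : {ae P, forall w, forall i, 0 <= X i w} by exact: filter_forall.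
  apply: filterS => w X0w; rewrite expr2 mulr_suml; apply: eq_bigr => i _.
  by rewrite mulr_sumr; apply: eq_bigr => j _; rewrite !ger0_norm.
Qed.

Definition independent X Y := forall A B : set R,
  measurable A -> measurable B ->
  P (X @^-1` A `&` Y @^-1` B) = (P (X @^-1` A) * P (Y @^-1` B))%E.

(** By independence the joint distribution is the product of the marginals, so
    the expectation of the product factors by Tonelli's theorem. *)
Lemma independent_cross_moment X Y : independent X Y ->
  cross_moment X Y =
  ((\int[P]_w (`|X w|)%:E) * (\int[P]_w (`|Y w|)%:E))%E.
Proof.
move=> XY.
have mXY : measurable_fun setT (fun w => (X w, Y w)).
  by apply: measurable_fun_pair; exact: measurable_funPT.
pose F (z : R * R) : \bar R := (`|z.1| * `|z.2|)%:E.
have mF : measurable_fun setT F.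
  by apply/measurable_EFinP; apply: measurable_funM; apply: measurableT_comp.
have F0 z : (0 <= F z)%E by rewrite lee_fin mulr_ge0.
have mn : measurable_fun setT (fun y : R => (`|y|)%:E : \bar R).
  exact/measurable_EFinP.
pose Z : {mfun Omega >-> (R * R)%type} :=
  HB.pack (fun w => (X w, Y w)) (isMeasurableFun.Build _ _ _ _ _ mXY).
transitivity (\int[distribution P Z]_z F z)%E.
  by rewrite ge0_integral_distribution.
rewrite (eq_measure_integral (distribution P X \x distribution P Y)%E); last first.
  move=> A mA _; apply/esym.
  by apply: product_measure_unique => // A1 B1 mA1 mB1; exact: XY.
rewrite fubini_tonelli1 // /fubini_F /F /=.
under eq_integral.
  move=> x _; under eq_integral do rewrite EFinM.
  rewrite ge0_integralZl //=.
  over.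
rewrite /=.
have c0 : (0 <= \int[distribution P Y]_y (`|y|)%:E)%E.
  by apply: integral_ge0 => y _; rewrite lee_fin.
under eq_integral do rewrite muleC.
rewrite ge0_integralZl //=.
by rewrite muleC !ge0_integral_distribution //.
Qed.

End Moments.

(** * Independence and equality in distribution *)

Section Independence.
Context {R : realType} {d : measure_display} {Omega : measurableType d}.
Variable P : probability Omega R.

Lemma mutually_independent_pair (I : finType) (X : I -> {RV P >-> R}) (i j : I) :
  mutually_independent X -> i != j -> independent (X i) (X j).
Proof.
move=> XI ij A B mA mB.
have := XI [set i; j]%SET (fun k => if k == i then A else B).
rewrite big_setU1 ?inE //= big_set1 eqxx eq_sym (negbTE ij) => <-; last first.
  by move=> k; case: ifP.
congr (P _); apply/seteqP; split => [w [Aw Bw] k /=|w H].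
  by rewrite !inE => /orP[/eqP ->|/eqP ->]; rewrite ?eqxx// eq_sym (negbTE ij).
split; first by have := H i; rewrite /= !inE eqxx => /(_ isT).
by have := H j; rewrite /= !inE eqxx orbT eq_sym (negbTE ij) => /(_ isT).
Qed.

(** A subfamily is tested on the image of the index set, with the full line as
    test set outside the range of [f]. *)
Lemma mutually_independent_reindex (I J : finType) (X : J -> {RV P >-> R})
    (f : I -> J) : injective f ->
  mutually_independent X -> mutually_independent (fun i => X (f i)).
Proof.
move=> f_inj XI K A mA.
pose A' j := if [pick i | f i == j] is Some i then A i else setT.
have A'f i : A' (f i) = A i.
  by rewrite /A'; case: pickP => [k /eqP/f_inj -> //|/(_ i)]; rewrite eqxx.
have mA' j : measurable (A' j) by rewrite /A'; case: pickP.
have := XI (f @: K)%SET A' mA'.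
rewrite big_imset /=; last by move=> i j _ _ /f_inj.
under eq_bigr do rewrite A'f.
move=> <-; congr (P _); apply/seteqP; split => w Hw.
  by move=> j /= /imsetP[i iK ->]; rewrite A'f; exact: Hw.
by move=> i iK; rewrite -A'f; apply: Hw; exact: imset_f.
Qed.

(** A constant lies in a test set with probability [0] or [1]: in the first case
    both sides vanish, in the second the constant can be dropped. *)
Lemma mutually_independent_cst (I J : finType) (X : I -> {RV P >-> R})
    (a : J -> R) :
  mutually_independent X ->
  mutually_independent (joint X (fun j => cst (a j) : {RV P >-> R})).
Proof.
move=> XI K A mA; rewrite big_sumType /=.
have cstE (j : J) : (cst (a j) : Omega -> R) @^-1` A (inr j) =
    if a j \in A (inr j) then setT else set0.
  case: ifPn => [/set_mem aA|/negP aA]; apply/seteqP; split => w //=.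
  by move=> aA'; apply: aA; exact: mem_set.
have [[j jK aA]|allA] := pselect (exists2 j, inr j \in K & a j \notin A (inr j)).
  rewrite [X in (_ * X)%E](bigD1 j) //= cstE (negbTE aA) measure0 mul0e mule0.
  rewrite (_ : \bigcap_(_ in _) _ = set0) ?measure0 //.
  apply/seteqP; split => w //= /(_ (inr j) jK) /=.
  by move/mem_set; rewrite (negbTE aA).
rewrite [X in (_ * X)%E]big1 ?mule1; last first.
  move=> j jK; rewrite cstE; case: ifPn => [_|aA]; first exact: probability_setT.
  by exfalso; apply: allA; exists j.
have H := XI [set i | inl i \in K]%SET (fun i => A (inl i)) (fun i => mA _).
rewrite (eq_bigl (fun i => inl i \in K)) in H; last by move=> i; rewrite inE.
rewrite -H; congr (P _); apply/seteqP; split => w Hw.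
  by move=> i /=; rewrite inE => iK; exact: (Hw (inl i)).
case=> [i iK|j jK] /=; first by apply: Hw; rewrite /= inE.
by apply/set_mem/negPn/negP => aA; apply: allA; exists j.
Qed.

End Independence.

Section SameDistribution.
Context {R : realType} {d d' : measure_display}.
Context {Omega : measurableType d} {Omega' : measurableType d'}.
Context {P : probability Omega R} {P' : probability Omega' R}.
Variables (X : {RV P >-> R}) (X' : {RV P' >-> R}).
Hypothesis XX' : same_distribution X X'.

(** The positive and the negative part are integrals against the common
    distribution; the equality holds whether or not they are finite. *)
Lemma same_distribution_integral (f : R -> \bar R) : measurable_fun setT f ->
  (\int[P]_w f (X w) = \int[P']_w f (X' w))%E.
Proof.
have nonneg (g : R -> \bar R) : measurable_fun setT g -> (forall x, 0 <= g x)%E ->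
    (\int[P]_w (g \o X) w = \int[P']_w (g \o X') w)%E.
  move=> mg g0; rewrite -!ge0_integral_distribution //.
  by apply: eq_measure_integral => A mA _; exact: XX'.
move=> mf; rewrite [LHS](integralE P setT (f \o X)).
rewrite [RHS](integralE P' setT (f \o X')).
rewrite (funepos_comp f X) (funeneg_comp f X).
rewrite (funepos_comp f X') (funeneg_comp f X').
rewrite (nonneg f^\+%E) ?(nonneg f^\-%E) //.
- exact: measurable_funeneg.
- exact: measurable_funepos.
Qed.

Lemma same_distribution_mean : mean P X = mean P' X'.
Proof.
rewrite /mean unlock.
by rewrite (@same_distribution_integral EFin) //; exact: measurable_EFin.
Qed.

Lemma same_distribution_second_moment : second_moment P X = second_moment P' X'.
Proof.
rewrite /second_moment unlock.
rewrite (@same_distribution_integral (fun x => (x ^+ 2)%:E)) //.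
by apply/measurable_EFinP; exact: measurable_funX.
Qed.

Lemma same_distribution_ae_ge0 :
  {ae P, forall w, 0 <= X w} -> {ae P', forall w, 0 <= X' w}.
Proof.
have m0 : measurable (~` [set x : R | 0 <= x]).
  by apply: measurableC; rewrite -set_itvcy; exact: measurable_itv.
move=> /negligibleP X0; apply/negligibleP.
  rewrite -[X in measurable X]/(X' @^-1` (~` [set x : R | 0 <= x])).
  rewrite -[X in measurable X]setTI.
  exact: measurable_funPT.
rewrite -[LHS]/(distribution P' X' (~` [set x : R | 0 <= x])) -XX' //; apply: X0.
rewrite -[X in measurable X]/(X @^-1` (~` [set x : R | 0 <= x])).
rewrite -[X in measurable X]setTI.
exact: measurable_funPT.
Qed.

End SameDistribution.

(** * Means and transforms of nonnegative variables *)

Section NonnegativeVariables.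
Context {R : realType} {d : measure_display} {Omega : measurableType d}.
Variable P : probability Omega R.
Implicit Types X Y : {RV P >-> R}.

Lemma ae_ge0_expectation X : {ae P, forall w, 0 <= X w} ->
  'E_P[X]%E = (\int[P]_w (`|X w|)%:E)%E.
Proof.
move=> X0; rewrite unlock; apply: ae_integral_eq.
- exact: measurable_funPT.
- exact: measurable_abs.
- by move: X0; apply: filterS => w X0; rewrite ger0_norm.
Qed.

Lemma ae_ge0_mean X : {ae P, forall w, 0 <= X w} -> 0 <= mean P X.
Proof.
by move=> X0; rewrite /mean ae_ge0_expectation // fine_ge0 // integral_ge0.
Qed.

(** Because [`|x| <= 1 + x^2]. *)
Lemma integral_norm_lty X : (second_moment P X < +oo)%E ->
  (\int[P]_w (`|X w|)%:E < +oo)%E.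
Proof.
move=> X2; apply: (@le_lt_trans _ _ (\int[P]_w (1 + (X w ^+ 2)%:E)%E)%E).
  apply: ge0_le_integral => //.
  - by apply/measurable_EFinP; exact: measurable_abs.
  - apply/measurable_EFinP; apply: measurable_funD => //.
    by apply: measurable_funX; exact: measurable_funPT.
  - move=> w _; rewrite -EFinD lee_fin -[X in _ <= 1 + X]real_normK ?num_real//.
    have := sqr_ge0 (`|X w| - 1); have := normr_ge0 (X w); nra.
rewrite ge0_integralD //; last first.
- by apply/measurable_EFinP/measurable_funX; exact: measurable_funPT.
- by move=> w _; rewrite lee_fin sqr_ge0.
rewrite integral_cst //= probability_setT mule1 lte_add_pinfty ?ltry //.
by move: X2; rewrite /second_moment unlock.
Qed.

Lemma norm_lty_integrable X : (\int[P]_w (`|X w|)%:E < +oo)%E ->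
  P.-integrable setT (EFin \o X).
Proof.
move=> X1; apply/integrableP; split; last exact: X1.
by apply/measurable_EFinP; exact: measurable_funPT.
Qed.

Lemma integrable_mean (f : Omega -> R) : P.-integrable setT (EFin \o f) ->
  'E_P[f]%E = (mean P f)%:E.
Proof. by move=> fi; rewrite /mean unlock fineK // integrable_fin_num. Qed.

Lemma mean_sum (I : finType) (f : I -> Omega -> R) :
  (forall i, P.-integrable setT (EFin \o f i)) ->
  mean P (fun w => \sum_i f i w) = \sum_i mean P (f i).
Proof.
move=> fi; rewrite /mean unlock.
under eq_integral do rewrite -sumEFin.
rewrite (@integral_sum _ _ _ P setT measurableT _ (fun i => EFin \o f i)) //.
by rewrite -sum_fine // => i _; apply: integrable_fin_num.
Qed.

Lemma mean_cst (a : R) : mean P (cst a) = a.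
Proof. by rewrite /mean expectation_cst. Qed.

Lemma integrable_cst (a : R) : P.-integrable setT (EFin \o (cst a : Omega -> R)).
Proof. exact: finite_measure_integrable_cst. Qed.

Lemma meanD (f g : Omega -> R) : P.-integrable setT (EFin \o f) ->
  P.-integrable setT (EFin \o g) ->
  mean P (fun w => f w + g w) = mean P f + mean P g.
Proof.
move=> fi gi; rewrite /mean unlock.
rewrite (@integralD_EFin _ _ _ P setT measurableT f g) // fineD //;
exact: integrable_fin_num.
Qed.

Lemma meanZ (a : R) (f : Omega -> R) : P.-integrable setT (EFin \o f) ->
  mean P (fun w => a * f w) = a * mean P f.
Proof.
move=> fi; rewrite /mean unlock.
rewrite (@integralZl _ _ _ P setT measurableT (EFin \o f) fi a) fineM //.
exact: integrable_fin_num.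
Qed.

Lemma mean_ge0 (f : Omega -> R) : (forall w, 0 <= f w) -> 0 <= mean P f.
Proof. by move=> f0; rewrite /mean fine_ge0 // expectation_ge0. Qed.

Lemma mean_eq0 (f : Omega -> R) : P.-integrable setT (EFin \o f) ->
  (forall w, 0 <= f w) -> mean P f = 0 -> {ae P, forall w, f w = 0}.
Proof.
move=> fi f0 mf.
have int0 : (\int[P]_w `|(EFin \o f) w| = 0)%E.
  under eq_integral do rewrite /= ger0_norm //.
  by have := integrable_mean fi; rewrite mf unlock.
have /(ae_eq_integral_abs P measurableT) : measurable_fun setT (EFin \o f).
  exact: measurable_int fi.
by case=> /(_ int0) + _; apply: filterS => w /(_ I) [].
Qed.

Lemma degenerate_atP X (a : R) :
  degenerate_at P X a <-> {ae P, forall w, X w = a}.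
Proof.
have m : measurable (X @^-1` [set a]).
  by rewrite -[X in measurable X]setTI; exact: measurable_funPT.
rewrite /degenerate_at; split => [Pa|[N [mN N0 sN]]].
  exists (~` (X @^-1` [set a])); split => //; first exact: measurableC.
  by rewrite probability_setC // Pa subee.
apply/eqP; rewrite eq_le probability_le1 //=.
have : (P (~` (X @^-1` [set a])) <= P N)%E.
  by apply: le_measure; rewrite ?inE //; exact: measurableC.
rewrite N0 probability_setC // => H.
by move: H; rewrite lee_subel_addr // ?add0e.
Qed.

End NonnegativeVariables.

Section Lst.
Context {R : realType} {d : measure_display} {Omega : measurableType d}.
Variables (P : probability Omega R) (X : {RV P >-> R}) (s : R).
Hypothesis s_gt0 : 0 < s.
Hypothesis X_ge0 : {ae P, forall w, 0 <= X w}.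
Hypothesis X_int : P.-integrable setT (EFin \o X).

(** [X] is replaced by [`|X|], which is almost surely equal to it, so that the
    bounds below hold at every point. *)
Let E w := expR (- (s * `|X w|)).

Let mE : measurable_fun setT E.
Proof.
apply: measurableT_comp => //; apply: measurableT_comp => //.
by apply: measurable_funM => //; exact: measurable_abs.
Qed.

Let E_int : P.-integrable setT (EFin \o E).
Proof.
apply: (le_integrable _ _ _ (integrable_cst P 1)) => //.
  exact/measurable_EFinP.
move=> w _ /=; rewrite lee_fin normr1 ger0_norm ?expR_ge0 //.
by rewrite -expR0 ler_expR oppr_le0 mulr_ge0 // ltW.
Qed.

Let lstE : lst P s X = mean P E.
Proof.
rewrite /lst /mean unlock; congr fine; apply: ae_integral_eq => //.
  apply: measurableT_comp => //; apply: measurableT_comp => //.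
  by apply: measurable_funM => //; exact: measurable_funPT.
by move: X_ge0; apply: filterS => w X0; rewrite /E ger0_norm.
Qed.

Let absX_int : P.-integrable setT (EFin \o (fun w => `|X w|)).
Proof. exact: integrable_norm. Qed.

Let mean_abs : mean P (fun w => `|X w|) = mean P X.
Proof. by rewrite /mean ae_ge0_expectation // unlock. Qed.

(** Equality would force [exp (- s X) = 1], that is [X = 0], almost surely. *)
Lemma lst_lt1 : 0 < mean P X -> lst P s X < 1.
Proof.
move=> X0; pose D w := 1 + -1 * E w.
have NE_int : P.-integrable setT (EFin \o (fun w => -1 * E w)).
  exact: (integrableZl measurableT (-1) E_int).
have D0 w : 0 <= D w.
  by rewrite /D mulN1r subr_ge0 -expR0 ler_expR oppr_le0 mulr_ge0 // ltW.
have Di : P.-integrable setT (EFin \o D).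
  exact: (integrableD measurableT (integrable_cst P 1) NE_int).
have mD : mean P D = 1 - lst P s X.
  rewrite (meanD (integrable_cst P 1) NE_int) mean_cst (meanZ _ E_int) lstE.
  by rewrite mulN1r.
rewrite -subr_gt0 -mD lt_neqAle mean_ge0 // andbT eq_sym.
apply: contraTneq X0 => /(mean_eq0 Di D0) D_eq0.
suff -> : mean P X = 0 by rewrite ltxx.
rewrite -mean_abs -[RHS](mean_cst P 0) /mean unlock; congr fine.
apply: ae_integral_eq => //; first exact: measurable_abs.
apply: filterS D_eq0 => w /eqP; rewrite /D mulN1r subr_eq0 -expR0 => /eqP/expR_inj.
by move/eqP; rewrite eq_sym oppr_eq0 mulf_eq0 gt_eqF //= => /eqP.
Qed.

(* [gap] is the difference between [exp (- s x)] and its tangent line at the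
   mean [mu], evaluated at [x = `|X w|]; it vanishes only for [x = mu]. *)
Let mu := mean P X.
Let b : R := - (expR (- (s * mu)) * (1 + s * mu)).
Let gap w := E w + (expR (- (s * mu)) * s * `|X w| + b).

Let gap_eq w : gap w = expR (- (s * mu)) *
  (expR (s * (mu - `|X w|)) - (1 + s * (mu - `|X w|))).
Proof.
rewrite /gap /b /E mulrBr -expRD.
have -> : - (s * mu) + s * (mu - `|X w|) = - (s * `|X w|) by ring.
ring.
Qed.

Let gap_ge0 w : 0 <= gap w.
Proof. by rewrite gap_eq mulr_ge0 ?expR_ge0 // subr_ge0 expR_ge1Dx. Qed.

Let lin_int : P.-integrable setT (EFin \o (fun w => expR (- (s * mu)) * s * `|X w|)).
Proof. exact: (integrableZl measurableT (expR (- (s * mu)) * s) absX_int). Qed.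

Let aff_int : P.-integrable setT (EFin \o (fun w =>
  expR (- (s * mu)) * s * `|X w| + b)).
Proof. exact: (integrableD measurableT lin_int (integrable_cst P b)). Qed.

Let gap_int : P.-integrable setT (EFin \o gap).
Proof. exact: (integrableD measurableT E_int aff_int). Qed.

Let gap_mean : mean P gap = lst P s X - expR (- (s * mu)).
Proof.
rewrite (meanD E_int aff_int) (meanD lin_int (integrable_cst P b)) mean_cst.
rewrite (meanZ _ absX_int) mean_abs lstE -/mu /b; ring.
Qed.

Lemma lst_ge : expR (- (s * mean P X)) <= lst P s X.
Proof. by rewrite -subr_ge0 -gap_mean mean_ge0. Qed.

(** If equality held, the nonnegative [gap] would have mean [0], and [X] would
    be almost surely equal to its mean. *)
Lemma lst_gt : ~ deterministic P X -> expR (- (s * mean P X)) < lst P s X.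
Proof.
move=> ndX; rewrite lt_neqAle lst_ge andbT eq_sym -subr_eq0 -gap_mean.
apply/eqP => /(mean_eq0 gap_int gap_ge0) gap0; apply: ndX; exists mu.
apply/degenerate_atP; apply: filterS2 X_ge0 gap0 => w X0 /eqP.
rewrite gap_eq mulf_eq0 gt_eqF ?expR_gt0 //= subr_eq0.
apply: contraTeq => Xmu; rewrite gt_eqF // expR_gt1Dx //.
by rewrite mulf_eq0 (gt_eqF s_gt0) /= subr_eq0 ger0_norm // eq_sym.
Qed.

End Lst.

(** * Second moments in the polling system *)

Section SecondMoments.
Context {R : realType} {N : nat} {d : measure_display} {Omega : measurableType d}.
Context {P : probability Omega R}.
Implicit Types S G : 'I_N -> {RV P >-> R}.

Lemma cross_moment_independent (X Y : {RV P >-> R}) :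
  {ae P, forall w, 0 <= X w} -> {ae P, forall w, 0 <= Y w} ->
  P.-integrable setT (EFin \o X) -> P.-integrable setT (EFin \o Y) ->
  independent X Y -> cross_moment P X Y = (mean P X * mean P Y)%:E.
Proof.
move=> X0 Y0 Xi Yi XY.
by rewrite independent_cross_moment // -!ae_ge0_expectation // !integrable_mean.
Qed.

(** The double sum of cross moments of the joint family of all [S i] and [G j]
    splits into four blocks; the two mixed ones factor by independence. *)
Lemma second_moment_switch_glue S G :
  (forall i, {ae P, forall w, 0 <= S i w}) ->
  (forall i, {ae P, forall w, 0 <= G i w}) ->
  (forall i, P.-integrable setT (EFin \o S i)) ->
  (forall i, P.-integrable setT (EFin \o G i)) ->
  (forall i j, independent (S i) (G j)) ->
  second_moment P (switch_glue S G) =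
  (second_moment P (total S)
   + (2 * (\sum_i mean P (G i)) * \sum_i mean P (S i))%:E
   + second_moment P (total G))%E.
Proof.
move=> S0 G0 Si Gi SG.
have -> : switch_glue S G = (fun w => \sum_k joint S G k w).
  by apply/funext => w; rewrite big_sumType /= /switch_glue big_split.
rewrite second_moment_sum; last by case.
rewrite big_sumType /=.
under eq_bigr do rewrite big_sumType /=.
under [X in (_ + X)%E]eq_bigr do rewrite big_sumType /=.
rewrite !big_split /= -!second_moment_sum //.
have cr : (\sum_i \sum_j cross_moment P (S i) (G j) =
    ((\sum_i mean P (G i)) * \sum_i mean P (S i))%:E)%E.
  under eq_bigr do under eq_bigr do rewrite cross_moment_independent //.
  rewrite mulrC mulr_suml -sumEFin; apply: eq_bigr => i _.
  by rewrite mulr_sumr -sumEFin.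
have -> : (\sum_i \sum_j cross_moment P (G i) (S j) =
    ((\sum_i mean P (G i)) * \sum_i mean P (S i))%:E)%E.
  rewrite -cr exchange_big; apply: eq_bigr => i _; apply: eq_bigr => j _.
  exact: cross_momentC.
rewrite cr addeA; congr (_ + _)%E; rewrite -addeA -EFinD; congr (_ + _%:E)%E.
ring.
Qed.

Lemma second_moment_total_lty S : mutually_independent S ->
  (forall i, {ae P, forall w, 0 <= S i w}) ->
  (forall i, (second_moment P (S i) < +oo)%E) ->
  (second_moment P (total S) < +oo)%E.
Proof.
move=> SI S0 S2; rewrite second_moment_sum //.
apply: lte_sum_pinfty => i _; apply: lte_sum_pinfty => j _.
have [<-|ij] := eqVneq i j; first by rewrite cross_moment_diag.
rewrite cross_moment_independent ?ltry //; last exact: mutually_independent_pair.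
- exact/norm_lty_integrable/integral_norm_lty.
- exact/norm_lty_integrable/integral_norm_lty.
Qed.

(** Jensen's inequality for the square: [t^2 >= 2 m t - m^2]. *)
Lemma second_moment_ge (f : Omega -> R) : P.-integrable setT (EFin \o f) ->
  ((mean P f ^+ 2)%:E <= second_moment P f)%E.
Proof.
move=> fi; rewrite /second_moment.
have mf : measurable_fun setT f by exact/measurable_EFinP/(measurable_int _ fi).
have mf2 : measurable_fun setT (fun w => f w ^+ 2) by exact: measurable_funX.
have [Voo|] := ltP 'E_P[fun w => (f w ^+ 2)%R]%E (+oo%E); last first.
  by rewrite leye_eq => /eqP ->; rewrite leey.
have f2i : P.-integrable setT (EFin \o (fun w => f w ^+ 2)).
  apply/integrableP; split; first exact/measurable_EFinP.
  rewrite unlock in Voo; apply: le_lt_trans Voo.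
  by apply: ge0_le_integral => //= [||w _];
    rewrite ?lee_fin ?ger0_norm ?sqr_ge0//; apply/measurable_EFinP => //;
    apply: measurableT_comp.
rewrite (integrable_mean f2i) lee_fin -subr_ge0.
set m := mean P f.
have e : mean P (fun w => f w ^+ 2 + (- (2 * m) * f w + m ^+ 2)) =
    mean P (fun w => f w ^+ 2) - m ^+ 2.
  have fz := integrableZl measurableT (- (2 * m)) fi.
  have fza := integrableD measurableT fz (integrable_cst P (m ^+ 2)).
  rewrite (meanD f2i fza) (meanD fz (integrable_cst P (m ^+ 2))).
  rewrite (mean_cst P (m ^+ 2)) (meanZ _ fi) -/m; ring.
rewrite -e mean_ge0 // => w.
have -> : f w ^+ 2 + (- (2 * m) * f w + m ^+ 2) = (f w - m) ^+ 2 by ring.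
exact: sqr_ge0.
Qed.

End SecondMoments.

Section SameTotal.
Context {R : realType} {N : nat} {d d' : measure_display}.
Context {Omega : measurableType d} {Omega' : measurableType d'}.
Context {P : probability Omega R} {P' : probability Omega' R}.
Variables (S : 'I_N -> {RV P >-> R}) (S' : 'I_N -> {RV P' >-> R}).

(** Diagonal cross moments are second moments of the marginals, the others
    products of their means. *)
Lemma same_second_moment_total :
  mutually_independent S -> mutually_independent S' ->
  (forall i, {ae P, forall w, 0 <= S i w}) ->
  (forall i, same_distribution (S i) (S' i)) ->
  second_moment P (total S) = second_moment P' (total S').
Proof.
move=> SI SI' S0 SS'.
have S0' i : {ae P', forall w, 0 <= S' i w}.
  by exact: same_distribution_ae_ge0 (SS' i) _.
have norm_eq i : (\int[P]_w (`|S i w|)%:E = \int[P']_w (`|S' i w|)%:E)%E.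
  rewrite (same_distribution_integral (SS' i) (f := fun x => (`|x|)%:E)) //.
  exact/measurable_EFinP.
rewrite !second_moment_sum //; apply: eq_bigr => i _; apply: eq_bigr => j _.
have [<-|ij] := eqVneq i j.
  by rewrite !cross_moment_diag (same_distribution_second_moment (SS' i)).
by rewrite !independent_cross_moment ?norm_eq //; exact: mutually_independent_pair.
Qed.

End SameTotal.

(** * The objective in terms of moments and transforms *)

Section ExtendedFormula.
Context {R : realType} {N : nat}.

Lemma sum_pinfty (F : 'I_N -> \bar R) : (0 < N)%N ->
  (forall i, F i = +oo%E) -> (\sum_i F i = +oo)%E.
Proof.
move=> N0 F_oo; rewrite (bigD1 (Ordinal N0)) //= F_oo addye //.
suff : (0 <= \sum_(i < N | i != Ordinal N0) F i)%E by case: (\sum_(i < N | _) _)%E.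
by apply: sume_ge0 => i _; rewrite F_oo leey.
Qed.

Lemma weighted_fin (a r s x k t : R) : k != 0 ->
  (a%:E * (r%:E * (s%:E + x%:E / k%:E) + t%:E))%E =
  (a * (r * (s + x / k) + t))%:E.
Proof. by move=> k0; rewrite inver (negbTE k0). Qed.

Lemma pinfty_div (s k : R) : 0 < k -> (s%:E + +oo / k%:E)%E = +oo%E.
Proof. by move=> k0; rewrite inver gt_eqF //= gt0_mulye ?lte_fin ?invr_gt0. Qed.

Lemma pinfty_scale (a r t : R) : 0 < a -> 0 < r ->
  (a%:E * (r%:E * +oo + t%:E))%E = +oo%E.
Proof.
by move=> a0 r0; rewrite gt0_muley ?lte_fin //= gt0_muley ?lte_fin.
Qed.

End ExtendedFormula.

Section Value.
Context {R : realType} {N : nat} {d : measure_display} {Omega : measurableType d}.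
Context {P : probability Omega R}.

(** The objective as a function of the second moment [v] of the total glue
    period and of the transforms [psi i] and means [g i] of the individual
    ones, the only features of the glue period distributions it depends on. *)
Definition objective_value (lam c : 'I_N -> R) (L : R)
    (B S : 'I_N -> {RV P >-> R}) (v : R) (psi g : 'I_N -> R) : R :=
  let rho := total_load lam B in
  let K := \sum_j mean P (S j) + L in
  \sum_i c i * (1 + load lam B i) / (rho + sq_load lam B)
    * (rho * (service_term lam B
              + (fine (second_moment P (total S))
                 + 2 * L * \sum_j mean P (S j) + v) / (2 * K))
       + K / (2 * (1 - rho)) * (rho ^+ 2 + sq_load lam B))
  + \sum_i c i * psi i / (1 - psi i) * (K / (1 - rho) - g i).

End Value.

Section System.
Context {R : realType} {N : nat} (lam nu c : 'I_N -> R) (L : R).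
Context {d : measure_display} {Omega : measurableType d} {P : probability Omega R}.
Variables (B S G : 'I_N -> {RV P >-> R}).
Hypothesis N_gt0 : (0 < N)%N.
Hypothesis c_gt0 : forall i, 0 < c i.
Hypothesis L_gt0 : 0 < L.
Hypothesis load_ge0 : forall i, 0 <= load lam B i.
Hypothesis rho_gt0 : 0 < total_load lam B.
Hypothesis S_indep : mutually_independent S.
Hypothesis S_ge0 : forall i, {ae P, forall w, 0 <= S i w}.
Hypothesis S_sq : forall i, (second_moment P (S i) < +oo)%E.
Hypothesis G_int : forall i, P.-integrable setT (EFin \o G i).
Hypothesis G_sum : \sum_i mean P (G i) = L.

Let V := second_moment P (total G).
Let K := \sum_j mean P (S j) + L.
Let psi i := lst P (nu i) (G i).
Let g i := mean P (G i).

Let S_int i : P.-integrable setT (EFin \o S i).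
Proof. exact/norm_lty_integrable/integral_norm_lty. Qed.

Let total_S_int : P.-integrable setT (EFin \o total S).
Proof.
have -> : EFin \o total S = (fun w => \sum_i (EFin \o S i) w)%E.
  by apply/funext => w; rewrite /total /= -sumEFin.
exact: integrable_sum.
Qed.

Lemma mean_total_S_plus : mean P (fun w => total S w + L) = K.
Proof.
by rewrite (meanD total_S_int (integrable_cst P L)) (mean_cst P L) (mean_sum S_int).
Qed.

Lemma mean_switch_glue : mean P (switch_glue S G) = K.
Proof.
rewrite /switch_glue (@mean_sum _ _ _ P _ (fun i w => S i w + G i w)); last first.
  by move=> i; exact: (integrableD measurableT (S_int i) (G_int i)).
rewrite /K -G_sum -big_split; apply: eq_bigr => i _.
exact: meanD (S_int i) (G_int i).
Qed.

Let K_gt0 : 0 < K.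
Proof. by apply: ltr_wpDl => //; apply: sumr_ge0 => i _; exact: ae_ge0_mean. Qed.

Let M := fine (second_moment P (total S)).
Let ME : second_moment P (total S) = M%:E.
Proof.
have ge0 : (0 <= second_moment P (total S))%E.
  by apply: expectation_ge0 => w; exact: sqr_ge0.
by rewrite /M fineK // ge0_fin_numE // second_moment_total_lty.
Qed.

Let sq_ge0 : 0 <= sq_load lam B.
Proof. by apply: sumr_ge0 => i _; exact: sqr_ge0. Qed.

Let coef_gt0 i : 0 < (1 + load lam B i) / (total_load lam B + sq_load lam B).
Proof. by rewrite divr_gt0 // ltr_pwDl. Qed.

Lemma constrained_objective_fin v : V = v%:E ->
  constrained_objective lam nu c L B S G =
  (objective_value lam c L B S v psi g)%:E.
Proof.
move=> Vv; rewrite /constrained_objective /objective_value mean_total_S_plus.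
rewrite -/V Vv ME -/M -/K.
rewrite EFinD; congr (_ + _)%E; rewrite -[RHS]sumEFin; apply: eq_bigr => i _ //.
by rewrite -!EFinD weighted_fin // mulf_neq0 // gt_eqF.
Qed.

Lemma constrained_objective_pinfty : V = +oo%E ->
  constrained_objective lam nu c L B S G = +oo%E.
Proof.
move=> Vv; rewrite /constrained_objective mean_total_S_plus -/V Vv ME -/K.
rewrite sum_pinfty // => [|i]; first by rewrite sumEFin.
rewrite -EFinD [(_%:E + +oo)%E]/= pinfty_div ?mulr_gt0 // pinfty_scale //.
by rewrite -mulrA mulr_gt0.
Qed.

Hypothesis G_ge0 : forall i, {ae P, forall w, 0 <= G i w}.
Hypothesis SG_indep : forall i j, independent (S i) (G j).

Let T2E : second_moment P (switch_glue S G) =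
  ((M + 2 * L * \sum_j mean P (S j))%:E + V)%E.
Proof. by rewrite second_moment_switch_glue // G_sum ME -EFinD. Qed.

Lemma objective_fin v : V = v%:E ->
  objective lam nu c B S G =
  (objective_value lam c L B S v psi g)%:E.
Proof.
move=> Vv; rewrite /objective /objective_value /waiting_time mean_switch_glue.
rewrite T2E Vv -/K -/M.
rewrite [RHS]EFinD -[X in _ = (X + _)%E]sumEFin -[X in _ = (_ + X)%E]sumEFin.
rewrite -[RHS]big_split; apply: eq_bigr => i _ /=.
have k0 : 2 * K != 0 by rewrite mulf_neq0 // gt_eqF.
rewrite inver (negbTE k0) -!(EFinD, EFinM) -/(psi i) -/(g i); congr (_%:E).
by rewrite /=; ring.
Qed.

(** Every coefficient of the infinite second moment is positive, so each term
    of the sum is infinite. *)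
Lemma objective_pinfty : V = +oo%E -> objective lam nu c B S G = +oo%E.
Proof.
move=> Vv; rewrite /objective sum_pinfty // => i.
rewrite /waiting_time mean_switch_glue T2E Vv.
rewrite [((M + _)%:E + +oo)%E]/= pinfty_div ?mulr_gt0 //.
by rewrite [(+oo + _)%E]/= pinfty_scale // [(+oo + _)%E]/= gt0_muley ?lte_fin.
Qed.

End System.

Section ObjectiveValue.
Context {R : realType} {N : nat} (lam c : 'I_N -> R) (L : R).
Context {d : measure_display} {Omega : measurableType d} {P : probability Omega R}.
Variables (B S : 'I_N -> {RV P >-> R}) (g : 'I_N -> R).
Hypothesis c_gt0 : forall i, 0 < c i.
Hypothesis load_ge0 : forall i, 0 <= load lam B i.
Hypothesis rho_gt0 : 0 < total_load lam B.
Hypothesis K_gt0 : 0 < \sum_j mean P (S j) + L.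
Hypothesis slack_gt0 : forall i,
  0 < (\sum_j mean P (S j) + L) / (1 - total_load lam B) - g i.

Let base (v : R) i := c i * (1 + load lam B i) / (total_load lam B + sq_load lam B)
    * (total_load lam B
         * (service_term lam B
            + (fine (second_moment P (total S))
               + 2 * L * \sum_j mean P (S j) + v)
              / (2 * (\sum_j mean P (S j) + L)))
       + (\sum_j mean P (S j) + L) / (2 * (1 - total_load lam B))
         * (total_load lam B ^+ 2 + sq_load lam B)).

Let base_le v1 v2 i : v1 <= v2 -> base v1 i <= base v2 i.
Proof.
have den_gt0 : 0 < total_load lam B + sq_load lam B.
  by rewrite ltr_pwDl // sumr_ge0 // => k _; exact: sqr_ge0.
move=> v12; rewrite /base ler_wpM2l //.
  rewrite mulr_ge0 ?invr_ge0 ?(ltW den_gt0) //.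
  by rewrite mulr_ge0 ?(ltW (c_gt0 i)) // addr_ge0.
rewrite lerD2r ler_wpM2l ?(ltW rho_gt0) // lerD2l ler_pM2r ?lerD2l //.
by rewrite invr_gt0 mulr_gt0.
Qed.

Let odds_le (p q : R) : p <= q -> q < 1 -> p / (1 - p) <= q / (1 - q).
Proof.
move=> pq q1; have q1' : 0 < 1 - q by lra.
have p1' : 0 < 1 - p by lra.
by rewrite ler_pdivrMr // mulrAC ler_pdivlMr //; lra.
Qed.

Let odds_lt (p q : R) : p < q -> q < 1 -> p / (1 - p) < q / (1 - q).
Proof.
move=> pq q1; have q1' : 0 < 1 - q by lra.
have p1' : 0 < 1 - p by lra.
by rewrite ltr_pdivrMr // mulrAC ltr_pdivlMr //; lra.
Qed.

Lemma objective_value_le v1 v2 psi1 psi2 : v1 <= v2 ->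
  (forall i, psi1 i <= psi2 i) -> (forall i, psi2 i < 1) ->
  objective_value lam c L B S v1 psi1 g <= objective_value lam c L B S v2 psi2 g.
Proof.
move=> v12 psi12 psi2_1; apply: lerD; apply: ler_sum => i _; first exact: base_le.
by rewrite ler_pM2r // -!mulrA ler_pM2l // odds_le.
Qed.

Lemma objective_value_lt v1 v2 psi1 psi2 i : v1 <= v2 ->
  (forall k, psi1 k <= psi2 k) -> (forall k, psi2 k < 1) -> psi1 i < psi2 i ->
  objective_value lam c L B S v1 psi1 g < objective_value lam c L B S v2 psi2 g.
Proof.
move=> v12 psi12 psi2_1 psi_i; apply: ler_ltD.
  by apply: ler_sum => k _; exact: base_le.
rewrite (bigD1 i) //= [ltRHS](bigD1 i) //=; apply: ltr_leD.
  by rewrite ltr_pM2r // -!mulrA ltr_pM2l // odds_lt.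
by apply: ler_sum => k _; rewrite ler_pM2r // -!mulrA ler_pM2l // odds_le.
Qed.

End ObjectiveValue.

Section ConstantVariables.
Context {R : realType} {N : nat} {d : measure_display} {Omega : measurableType d}.
Context {P : probability Omega R}.
Variable (G : 'I_N -> {RV P >-> R}) (g : 'I_N -> R).
Hypothesis G_g : forall i, degenerate_at P (G i) (g i).

Let Gg_ae : {ae P, forall w, forall i, G i w = g i}.
Proof. by apply: filter_forall => i; exact/degenerate_atP. Qed.

Let Gi_ae i : {ae P, forall w, G i w = g i}.
Proof. exact/degenerate_atP. Qed.

Lemma degenerate_second_moment_total :
  second_moment P (total G) = ((\sum_i g i) ^+ 2)%:E.
Proof.
rewrite -[RHS](expectation_cst P) /second_moment unlock.
apply: ae_integral_eq => //.
  by apply: measurable_funX; apply: measurable_sum => i; exact: measurable_funPT.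
move: Gg_ae; apply: filterS => w Gw; rewrite /total; congr (_ ^+ 2).
exact: eq_bigr.
Qed.

Lemma degenerate_lst s i : lst P s (G i) = expR (- (s * g i)).
Proof.
rewrite /lst -[RHS](mean_cst P) /mean unlock; congr fine.
apply: ae_integral_eq => //.
  apply: measurableT_comp => //; apply: measurableT_comp => //.
  by apply: measurable_funM => //; exact: measurable_funPT.
by move: (Gi_ae i); apply: filterS => w ->.
Qed.

Lemma degenerate_mean i : mean P (G i) = g i.
Proof.
by rewrite -[RHS](mean_cst P) /mean unlock; congr fine; apply: ae_integral_eq.
Qed.

End ConstantVariables.

Lemma deterministic_glue_degenerate (R : realType) (N : nat) (d : measure_display)
    (Omega : measurableType d) (P : probability Omega R) (g : 'I_N -> R) i :
  degenerate_at P (deterministic_glue P g i) (g i).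
Proof.
rewrite /degenerate_at (_ : _ @^-1` _ = setT) ?probability_setT //.
by apply/seteqP; split.
Qed.

(** * Glue designs *)

Section GlueDesign.
Context {R : realType} {N : nat} (lam nu c : 'I_N -> R) (L : R).
Context {d : measure_display} {Omega : measurableType d} {P : probability Omega R}.
Variables B S : 'I_N -> {RV P >-> R}.
Hypothesis N_gt0 : (0 < N)%N.
Hypothesis lam_gt0 : forall i, 0 < lam i.
Hypothesis nu_gt0 : forall i, 0 < nu i.
Hypothesis c_gt0 : forall i, 0 < c i.
Hypothesis L_gt0 : 0 < L.
Hypothesis BS_indep : mutually_independent (joint B S).
Hypothesis B_ge0 : forall i, {ae P, forall w, 0 <= B i w}.
Hypothesis S_ge0 : forall i, {ae P, forall w, 0 <= S i w}.
Hypothesis S_sq : forall i, (second_moment P (S i) < +oo)%E.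
Hypothesis rho_gt0 : 0 < total_load lam B.
Hypothesis rho_lt1 : total_load lam B < 1.

Lemma load_ge0 i : 0 <= load lam B i.
Proof. by rewrite mulr_ge0 ?(ltW (lam_gt0 i)) // ae_ge0_mean. Qed.

Lemma sum_mean_S_ge0 : 0 <= \sum_j mean P (S j).
Proof. by apply: sumr_ge0 => j _; exact: ae_ge0_mean. Qed.

(** The mean cycle time exceeds the total mean glue period. *)
Lemma cycle_gt : L < (\sum_j mean P (S j) + L) / (1 - total_load lam B).
Proof.
have := sum_mean_S_ge0; set s := \sum_j _ => s0.
have := mulr_gt0 L_gt0 rho_gt0; rewrite ltr_pdivlMr ?subr_gt0 //; lra.
Qed.

Lemma reduced_objectiveE g : feasible L g ->
  reduced_objective lam nu c L B S g =
  objective_value lam c L B S (L ^+ 2) (fun i => expR (- (nu i * g i))) g.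
Proof.
move=> [g0 gL]; rewrite /reduced_objective /objective_value mean_total_S_plus //.
congr (_ + _); apply: eq_bigr => i _; congr (_ * _); rewrite -mulrA; congr (_ * _).
have : expR (- (nu i * g i)) < 1 by exact: expR_neg_lt1.
by move=> e1; field; lra.
Qed.

Lemma deterministic_design g : feasible L g ->
  glue_design B S L B S (deterministic_glue P g).
Proof.
move=> [g0 gL]; split => //.
- exact: mutually_independent_cst.
- by move=> i; apply: aeW => w /=; exact: ltW.
- split=> [i|]; first by rewrite expectation_cst lte_fin.
  by rewrite -gL -sumEFin; apply: eq_bigr => i _; rewrite expectation_cst.
Qed.

Section Design.
Context {d' : measure_display} {Omega' : measurableType d'}.
Context {P' : probability Omega' R}.
Variables B' S' G' : 'I_N -> {RV P' >-> R}.
Hypothesis design : glue_design B S L B' S' G'.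

Let g i := mean P' (G' i).

Let BB' i : same_distribution (B i) (B' i). Proof. by case: design. Qed.
Let SS' i : same_distribution (S i) (S' i). Proof. by case: design. Qed.
Let indep : mutually_independent (joint (joint B' S') G').
Proof. by case: design. Qed.
Let G_ge0 i : {ae P', forall w, 0 <= G' i w}. Proof. by case: design. Qed.

Let S'_ge0 i : {ae P', forall w, 0 <= S' i w}.
Proof. exact: same_distribution_ae_ge0 (SS' i) (S_ge0 i). Qed.

Let S'_sq i : (second_moment P' (S' i) < +oo)%E.
Proof. by rewrite -(same_distribution_second_moment (SS' i)). Qed.

Let S'_indep : mutually_independent S'.
Proof.
apply: (mutually_independent_reindex (f := fun i : 'I_N => inl (inr i)) _ indep).
by move=> i j [].
Qed.

Let SG_indep i j : independent (S' i) (G' j).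
Proof.
exact: (mutually_independent_pair (i := inl (inr i)) (j := inr j) indep).
Qed.

Let S_indep : mutually_independent S.
Proof.
apply: (mutually_independent_reindex (f := fun i : 'I_N => inr i) _ BS_indep).
by move=> i j [].
Qed.

Let G_lty i : ('E_P'[G' i] < +oo)%E.
Proof.
have [_ _ _ _ [G0 GL]] := design.
apply: le_lt_trans (ltry L); rewrite -GL (bigD1 i) //= leeDl //.
by apply: sume_ge0 => k _; exact: ltW.
Qed.

Lemma design_integrable i : P'.-integrable setT (EFin \o G' i).
Proof. by apply: norm_lty_integrable; rewrite -ae_ge0_expectation. Qed.

Lemma design_feasible : feasible L g.
Proof.
have [_ _ _ _ [G0 GL]] := design; split=> [i|].
  by have := G0 i; rewrite integrable_mean ?lte_fin //; exact: design_integrable.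
apply: EFin_inj; rewrite -GL -sumEFin; apply: eq_bigr => i _.
by rewrite integrable_mean //; exact: design_integrable.
Qed.

Let g_le i : g i <= L.
Proof.
by have [g0 gL] := design_feasible; apply: feasible_le => // k; exact: ltW.
Qed.

Let load_eq : load lam B' = load lam B.
Proof. by apply/funext => i; rewrite /load (same_distribution_mean (BB' i)). Qed.

Let rho_eq : total_load lam B' = total_load lam B.
Proof. by rewrite /total_load load_eq. Qed.

Lemma design_value v psi h :
  objective_value lam c L B' S' v psi h = objective_value lam c L B S v psi h.
Proof.
have meanS : \sum_j mean P' (S' j) = \sum_j mean P (S j).
  by apply: eq_bigr => j _; rewrite (same_distribution_mean (SS' j)).
have service : service_term lam B' = service_term lam B.
  rewrite /service_term rho_eq; congr (_ / _); apply: eq_bigr => i _.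
  by rewrite (same_distribution_second_moment (BB' i)).
have sq : sq_load lam B' = sq_load lam B by rewrite /sq_load load_eq.
rewrite /objective_value meanS service sq rho_eq load_eq.
by rewrite -(same_second_moment_total S_indep S'_indep).
Qed.

Let load_ge0' i : 0 <= load lam B' i.
Proof. by rewrite load_eq; exact: load_ge0. Qed.

Let rho'_gt0 : 0 < total_load lam B'. Proof. by rewrite rho_eq. Qed.

Lemma design_objective :
  objective lam nu c B' S' G' = constrained_objective lam nu c L B' S' G'.
Proof.
have [_ gL] := design_feasible.
have Gi := design_integrable.
case V : (second_moment P' (total G')) => [v||].
- by rewrite (objective_fin lam nu c B' L_gt0 _ _ _ Gi gL _ _ V) //
    (constrained_objective_fin lam nu c B' L_gt0 _ _ _ V).
- by rewrite (objective_pinfty nu N_gt0 c_gt0 L_gt0 load_ge0' rho'_gt0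
      _ _ _ Gi gL _ _ V) //
    (constrained_objective_pinfty nu N_gt0 c_gt0 L_gt0 load_ge0' rho'_gt0 _ _ _ V).
- have : (0 <= second_moment P' (total G'))%E.
    by apply: expectation_ge0 => w; exact: sqr_ge0.
  by rewrite V.
Qed.

Lemma degenerate_constrained (G1 : 'I_N -> {RV P' >-> R}) (h : 'I_N -> R) :
  feasible L h -> (forall i, degenerate_at P' (G1 i) (h i)) ->
  constrained_objective lam nu c L B' S' G1 =
  (reduced_objective lam nu c L B S h)%:E.
Proof.
move=> hf Gh; have [h0 hL] := hf.
have V : second_moment P' (total G1) = (L ^+ 2)%:E.
  by rewrite (degenerate_second_moment_total Gh) hL.
rewrite (constrained_objective_fin lam nu c B' L_gt0 _ _ _ V) // design_value.
rewrite reduced_objectiveE //; congr (_%:E); rewrite /objective_value.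
congr (_ + _); apply: eq_bigr => i _.
by rewrite (degenerate_lst Gh) (degenerate_mean Gh).
Qed.

Let K_gt0 : 0 < \sum_j mean P (S j) + L.
Proof. by rewrite ltr_wpDl // sum_mean_S_ge0. Qed.

Let slack_gt0 i : 0 < (\sum_j mean P (S j) + L) / (1 - total_load lam B) - g i.
Proof. by rewrite subr_gt0; apply: le_lt_trans (g_le i) cycle_gt. Qed.

Let second_moment_total_ge : ((L ^+ 2)%:E <= second_moment P' (total G'))%E.
Proof.
have [_ gL] := design_feasible.
have <- : mean P' (total G') = L by rewrite (mean_sum design_integrable).
apply: second_moment_ge.
have -> : EFin \o total G' = (fun w => \sum_i (EFin \o G' i) w)%E.
  by apply/funext => w; rewrite /total /= -sumEFin.
by apply: integrable_sum => // i _; exact: design_integrable.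
Qed.

Let lst_G_lt1 i : lst P' (nu i) (G' i) < 1.
Proof.
have [g0 _] := design_feasible.
by apply: lst_lt1 => //; exact: g0.
Qed.

Let lst_G_ge i : expR (- (nu i * g i)) <= lst P' (nu i) (G' i).
Proof. by apply: lst_ge => //; exact: design_integrable. Qed.

Let lst_G_gt i : ~ deterministic P' (G' i) ->
  expR (- (nu i * g i)) < lst P' (nu i) (G' i).
Proof. by apply: lst_gt => //; exact: design_integrable. Qed.

(** Jensen's inequality, applied to the second moment of the total glue period
    and to each transform. *)
Lemma design_ge :
  ((reduced_objective lam nu c L B S g)%:E <=
   constrained_objective lam nu c L B' S' G')%E.
Proof.
case V : (second_moment P' (total G')) second_moment_total_ge => [v||] //.
  rewrite lee_fin => Lv.
  rewrite (constrained_objective_fin lam nu c B' L_gt0 _ _ _ V) //.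
  rewrite design_value lee_fin.
  rewrite reduced_objectiveE; last exact: design_feasible.
  by apply: objective_value_le => //; exact: load_ge0.
by rewrite (constrained_objective_pinfty nu N_gt0 c_gt0 L_gt0 load_ge0' rho'_gt0
  _ _ _ V) ?leey.
Qed.

Lemma design_gt : (exists i, ~ deterministic P' (G' i)) ->
  ((reduced_objective lam nu c L B S g)%:E <
   constrained_objective lam nu c L B' S' G')%E.
Proof.
move=> [i Gi_nd].
case V : (second_moment P' (total G')) second_moment_total_ge => [v||] //.
  rewrite lee_fin => Lv.
  rewrite (constrained_objective_fin lam nu c B' L_gt0 _ _ _ V) //.
  rewrite design_value lte_fin.
  rewrite reduced_objectiveE; last exact: design_feasible.
  have lst_gti := lst_G_gt Gi_nd.
  by apply: objective_value_lt lst_gti => //; exact: load_ge0.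
by rewrite (constrained_objective_pinfty nu N_gt0 c_gt0 L_gt0 load_ge0' rho'_gt0
  _ _ _ V) ?ltry.
Qed.

End Design.

Lemma deterministic_objective g : feasible L g ->
  objective lam nu c B S (deterministic_glue P g) =
  (reduced_objective lam nu c L B S g)%:E.
Proof.
move=> gf; have dg := deterministic_design gf.
rewrite (design_objective dg) (degenerate_constrained dg gf) // => i.
exact: deterministic_glue_degenerate.
Qed.

(** An optimal design is compared with the constant designs on the original
    space: the one at its own means forces it to be constant, the others make
    its means a minimum point. *)
Lemma optimal_designP (d' : measure_display) (Omega' : measurableType d')
    (P' : probability Omega' R) (B' S' G' : 'I_N -> {RV P' >-> R}) :
  glue_design B S L B' S' G' ->
  let g i := mean P' (G' i) in
  optimal_glue_design lam nu c B S L B' S' G' <->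
  is_minimum_point lam nu c L B S g /\ forall i, degenerate_at P' (G' i) (g i).
Proof.
move=> design g; have gf : feasible L g := design_feasible design.
split=> [[_ opt]|[[_ gmin] Gg]].
  have le_det h : feasible L h ->
      (objective lam nu c B' S' G' <= (reduced_objective lam nu c L B S h)%:E)%E.
    move=> hf; rewrite -deterministic_objective //.
    exact/opt/deterministic_design.
  split.
    split=> // h hf; rewrite -lee_fin; apply: le_trans (le_det _ hf).
    by rewrite design_objective //; exact: design_ge.
  move=> i; have [[a Ga]|Gi_nd] := pselect (deterministic P' (G' i)).
    suff -> : g i = a by [].
    rewrite /g -[RHS](mean_cst P') /mean unlock; congr fine.
    by apply: ae_integral_eq => //; exact/degenerate_atP.
  have := le_det _ gf; rewrite design_objective // leNgt.
  by rewrite design_gt //; exists i.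
split=> // d1 Omega1 P1 B1 S1 G1 design1.
rewrite (design_objective design) (degenerate_constrained design gf Gg).
rewrite (design_objective design1); apply: le_trans (design_ge design1).
by rewrite lee_fin gmin //; exact: design_feasible design1.
Qed.

End GlueDesign.

(** * The optimal glue periods *)

Theorem mainTheorem4 (R : realType) (N : nat) (lam nu c : 'I_N -> R) (L : R)
    (d : measure_display) (Omega : measurableType d) (P : probability Omega R)
    (B S : 'I_N -> {RV P >-> R})
    (N_gt0 : (0 < N)%N)
    (lam_gt0 : forall i, 0 < lam i)
    (nu_gt0 : forall i, 0 < nu i)
    (c_gt0 : forall i, 0 < c i)
    (L_gt0 : 0 < L)
    (BS_indep : mutually_independent (joint B S))
    (B_ge0 : forall i, {ae P, forall w, 0 <= B i w})
    (S_ge0 : forall i, {ae P, forall w, 0 <= S i w})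
    (B_sq : forall i, (second_moment P (B i) < +oo)%E)
    (S_sq : forall i, (second_moment P (S i) < +oo)%E)
    (rho_gt0 : 0 < total_load lam B)
    (rho_lt1 : total_load lam B < 1) :
  let U := reduced_objective lam nu c L B S in
  let f := multiplier_fun lam nu c L B S in
  let minimum_point := is_minimum_point lam nu c L B S in
  (* the objective function and the reduction to deterministic glue periods *)
  ((forall (d' : measure_display) (Omega' : measurableType d')
      (P' : probability Omega' R) (B' S' G' : 'I_N -> {RV P' >-> R}),
      glue_design B S L B' S' G' ->
      let g i := mean P' (G' i) in
      [/\ objective lam nu c B' S' G' =
            constrained_objective lam nu c L B' S' G',
          (exists i, ~ deterministic P' (G' i)) ->
          (constrained_objective lam nu c L B' S' (deterministic_glue P' g) <
           constrained_objective lam nu c L B' S' G')%E &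
          optimal_glue_design lam nu c B S L B' S' G' <->
          minimum_point g /\ forall i, degenerate_at P' (G' i) (g i)]) /\
   (forall g, feasible L g ->
      glue_design B S L B S (deterministic_glue P g) /\
      objective lam nu c B S (deterministic_glue P g) = (U g)%:E)) /\
  (* existence of a minimum point and of a Lagrange multiplier *)
  ((exists g, minimum_point g) /\
   (forall g, minimum_point g ->
      exists kappa, forall i,
        is_derive (g i) 1 (fun x => U (fun k => if k == i then x else g k))
          kappa /\
        f i (g i) = kappa)) /\
  (* properties of the functions f_i *)
  (forall i,
     [/\ set_bij `]0, L[ `]-oo, f i L[ (f i),
         {in `]0, L[, continuous (f i)} &
         {in `]0, L[ &, {homo f i : x y / x < y}}]) /\
  exists h : 'I_N -> R -> R,
    (* the inverse functions h_i *)
    (forall i,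
       [/\ set_fun `]-oo, f i L[ `]0, L[ (h i),
           {in `]0, L[, cancel (f i) (h i)},
           {in `]-oo, f i L[, cancel (h i) (f i)},
           {in `]-oo, f i L[, continuous (h i)} &
           {in `]-oo, f i L[ &, {homo h i : x y / x < y}}]) /\
    (* the optimal solution *)
    ((1 < N)%N ->
     exists kappa,
       [/\ (forall i, kappa < f i L) /\ \sum_i h i kappa = L,
           (forall kappa', (forall i, kappa' < f i L) ->
              \sum_i h i kappa' = L -> kappa' = kappa) &
           forall g, minimum_point g <-> (forall i, g i = h i kappa)]).
Proof.
move=> U f minimum_point.
pose A := (\sum_j mean P (S j) + L) / (1 - total_load lam B).
have LA : L <= A by apply: ltW; exact: cycle_gt.
have fE i : f i = retrial_slope (c i) (nu i) A by [].
have [C UE] : exists C, forall g,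
    U g = C + \sum_i retrial_cost (c i) (nu i) A (g i) by eexists.
have f_lt i (x y : R) : 0 < x -> x < y -> y <= L -> f i x < f i y.
  by move=> x0 xy yL; rewrite fE retrial_slope_lt // (le_trans yL).
have f_cont i (x : R) : 0 < x -> {for x, continuous (f i)}.
  exact: retrial_slope_continuous.
have f_unb i (k : R) : exists2 x, 0 < x < L & f i x <= k.
  exact: retrial_slope_unbounded.
have [h hP] := choice (fun i => slope_inverse (f_lt i) (f_cont i) (f_unb i)).
have h_fun i : set_fun `]-oo, f i L[ `]0, L[ (h i) by case: (hP i).
have fK i : {in `]0, L[, cancel (f i) (h i)} by case: (hP i).
have hK i : {in `]-oo, f i L[, cancel (h i) (f i)} by case: (hP i).
have h_cont i : {in `]-oo, f i L[, continuous (h i)} by case: (hP i).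
have h_lt i : {in `]-oo, f i L[ &, {homo h i : x y / x < y}} by case: (hP i).
have equal_slopes_minimum g kappa : feasible L g -> (forall i, f i (g i) = kappa) ->
    forall g', minimum_point g' <-> (forall i, g' i = g i).
  move=> gf gk.
  have g_lt g' : feasible L g' -> (exists i, g i != g' i) -> U g < U g'.
    by move=> gf' gg'; rewrite !UE ltrD2l;
      exact: (equal_slopes_optimal c_gt0 nu_gt0 LA gf gf' gk gg').
  have differ g' : (forall i, g' i = g i) \/ exists i, g i != g' i.
    have [|/existsNP[i gi]] := pselect (forall i, g' i = g i); first by left.
    by right; exists i; apply/eqP => e; apply: gi.
  move=> g'; split=> [[gf' gmin]|/funext ->].
    have [//|/(g_lt _ gf')] := differ g'.
    by rewrite ltNge gmin.
  split=> // g1 gf1; have [/funext -> //|/(g_lt _ gf1)/ltW //] := differ g1.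
have optimum : (1 < N)%N -> exists kappa,
    [/\ (forall i, kappa < f i L) /\ \sum_i h i kappa = L,
        (forall kappa', (forall i, kappa' < f i L) ->
           \sum_i h i kappa' = L -> kappa' = kappa) &
        feasible L (h^~ kappa) /\ forall i, f i (h i kappa) = kappa].
  move=> N_gt1.
  have [kappa [kL sk]] := multiplier_exists N_gt1 L_gt0 f_lt h_fun fK h_cont h_lt.
  exists kappa; split => //.
    move=> kappa' kL' sk'; apply: (multiplier_unique N_gt1 h_lt kL' kL).
    by rewrite sk' sk.
  split=> [|i]; last by apply: hK; rewrite in_itv /= kL.
  split=> // i; have := @h_fun i kappa; rewrite /= !in_itv /= => /(_ (kL i)).
  by case/andP.
(* For [N = 1] the constraint leaves only [L], with multiplier [f i L]. *)
have [g0 [kappa0 [g0f g0k]]] : exists g kappa,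
    feasible L g /\ forall i, f i (g i) = kappa.
  have [/optimum [kappa [_ _ [? ?]]]|N_le1] := ltnP 1 N.
    by exists (h^~ kappa), kappa.
  pose i0 := Ordinal N_gt0.
  have all_i0 i : i = i0.
    apply: val_inj => /=; apply/eqP; rewrite -leqn0 -ltnS.
    exact: leq_trans (ltn_ord i) N_le1.
  exists (fun=> L), (f i0 L); split=> [|i]; last by rewrite (all_i0 i).
  split=> // ; rewrite (bigD1 i0) //= big1 ?addr0 // => i.
  by rewrite (all_i0 i) eqxx.
split; last split; last split.
- split=> [d' Omega' P' B' S' G' design g|g gf].
    have gf : feasible L g by exact: design_feasible design.
    split.
    + by apply: (@design_objective R N lam nu c L _ _ P B S).
    + move=> nondet; rewrite (degenerate_constrained lam c nu_gt0 L_gt0 BS_indep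
        S_ge0 S_sq design gf) => [|i].
        by apply: design_gt.
      exact: deterministic_glue_degenerate.
    + by apply: optimal_designP.
  by split; [apply: deterministic_design|apply: deterministic_objective].
- split=> [|g gmin]; first by exists g0; apply/(equal_slopes_minimum _ _ g0f g0k).
  have /(equal_slopes_minimum _ _ g0f g0k)/funext -> := gmin.
  exists kappa0 => i; split => //.
  pose D := C + \sum_(k | k != i) retrial_cost (c k) (nu k) A (g0 k).
  have -> : (fun x => U (fun k => if k == i then x else g0 k)) =
      (fun x => D + retrial_cost (c i) (nu i) A x).
    apply/funext => x; rewrite UE (bigD1 i) //= eqxx addrCA addrC; congr (_ + _ + _).
    by apply: eq_bigr => k /negbTE ->.
  have gi0 : 0 < g0 i by case: g0f.
  have dcost := retrial_cost_is_derive (c i) A (nu_gt0 i) gi0.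
  rewrite -(g0k i) fE; by apply: is_derive_eq; rewrite add0r mul1r.
- move=> i; split.
  + exact: slope_set_bij (f_lt i) (f_cont i) (f_unb i).
  + by move=> x; rewrite in_itv /= => /andP[x0 _]; exact: f_cont.
  + move=> x y; rewrite !in_itv /= => /andP[x0 _] /andP[_ yL] xy.
    by apply: f_lt => //; exact: ltW.
- exists h; split => // /optimum [kappa [kL kuniq [hf hk]]].
  exists kappa; split => // g.
  exact: equal_slopes_minimum hf hk g.
Qed.
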